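(* Fix $n\ge1$. There exist $\epsilon_0>0$ and a function $K\colon[0,\epsilon_0)\to[0,\infty)$ with $K(\epsilon)\to0^+$ as $\epsilon\to0^+$ such that for every $0\le\epsilon<\epsilon_0$: (i) every linear map $\mathbb{R}^{2n}\to\mathbb{R}^{2n}$ that has the linear $\epsilon$-non-squeezing and the linear $\epsilon$-non-expanding property is $K(\epsilon)$-symplectic or $K(\epsilon)$-anti-symplectic; and (ii) for every $r>0$ and every normalized symplectic capacity $c$ on $\mathbb{R}^{2n}$, if an embedding $\varphi\colon B_r^{2n}\to\mathbb{R}^{2n}$ preserves the capacity of ellipsoids up to $\epsilon$ (with respect to $c$), then, with $\epsilon'=K(\epsilon)$, $\varphi$ is $\epsilon'$-symplectic or $\epsilon'$-anti-symplectic.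
   Context: $\mathbb{R}^{2n}$ carries the standard metric and the standard symplectic form $\omega_0=\sum_{j=1}^n dx_j\wedge dy_j$; $B_r^{2n}$ is the ball of radius $r$ centered at the origin (open when it is the domain of $\varphi$, closed when ellipsoids are formed from it). For a two-form $\beta$, $\|\beta(x)\|_2$ is the Euclidean norm of the coefficient vector of $\beta(x)$ in the basis of wedge products (with increasing indices) of the standard orthonormal coframe, and $\|\beta\|_2=\sup_x\|\beta(x)\|_2$. A smooth embedding (or linear map) $\varphi$ is $\epsilon$-symplectic if $\|\varphi^*\omega_0-\omega_0\|_2\le\epsilon$ and $\epsilon$-anti-symplectic if $\|\varphi^*\omega_0+\omega_0\|_2\le\epsilon$. A (normalized symplectic) capacity on $\mathbb{R}^{2n}$ assigns to each subset $U\subset\mathbb{R}^{2n}$ a number $c(U)\in[0,\infty]$ such that: (monotonicity) if there is a symplectic embedding $\psi\colon U\to\mathbb{R}^{2n}$ with $\psi(U)\subset V$, then $c(U)\le c(V)$ (for arbitrary $U$, $\psi$ is the restriction of a symplectic embedding of an open neighborhood of $U$); (conformality) $c(aU)=a^2c(U)$ for $a\neq0$; (normalization) $c(B_1^{2n})=\pi=c(Z_1^{2n})$, where $Z_1^{2n}=B_1^2\times\mathbb{R}^{2n-2}$. For a non-singular $2n\times2n$ matrix $A$, $E(A)=AB_1^{2n}$ (image of the closed unit ball). There is a linear symplectic map $\Psi$ with $\Psi E(A)=\{z\in\mathbb{C}^n\mid\sum_j|z_j/r_j|^2\le1\}$ for a unique tuple $0<r_1\le\dots\le r_n$, and $r_1$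 is the linear symplectic width of $E(A)$; degenerate ellipsoids (images of $B_1^{2n}$ under singular matrices) have linear symplectic width $0$. Given $0\le\epsilon<1$, put $\rho=\sqrt{1-\epsilon}$, let $r_A$ be the smallest number with $E(A)\subset B_{r_A}^{2n}$, $s_A=(1+\|A^{-1}\|(\rho^{-1}-1)r_A)^{-1}$, and, if $\|A^{-1}\|(\rho^{-1}-1)r_A<1$, $e_A=(1-\|A^{-1}\|(\rho^{-1}-1)r_A)^{-1}$; $\|\cdot\|$ is the operator norm. A linear map $\Phi$ has the linear $\epsilon$-non-squeezing property if for every $E(A)$ with linear symplectic width $r_1$, the linear symplectic width $R_1$ of $\Phi E(A)$ satisfies $s_Ar_1\le R_1$. It has the linear $\epsilon$-non-expanding property if for all $r>0$ the linear symplectic width of $\Phi B_r^{2n}$ is at most $\rho^{-1}r$ and, for every $E(A)$ with linear symplectic width $r_1$ for which $e_A$ is defined, the linear symplectic width $R_1$ of $\Phi E(A)$ satisfies $R_1\le e_Ar_1$. An embedding $\varphi\colon U\to\mathbb{R}^{2n}$, $U\subset\mathbb{R}^{2n}$, preserves the capacity of ellipsoids up to $\epsilon$ (with respect to $c$) if $s_A^2\,c(E)\le c(\varphi(E))\le e_A^2\,c(E)$ for every ellipsoid $E\subset U$ that is a translate of some $E(A)$, $A$ non-singular, the second inequality being required whenever $e_A$ is defined. *)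

(* Defs.v *)
From HB Require Import structures.
From mathcomp Require Import all_boot all_order all_algebra.
From mathcomp Require Import all_classical all_reals all_analysis.

Set Implicit Arguments.
Unset Strict Implicit.
Unset Printing Implicit Defensive.

Import Order.TTheory GRing.Theory Num.Theory.
Import numFieldNormedType.Exports.

Local Open Scope classical_set_scope.
Local Open Scope ring_scope.

(* R^{2n} as column vectors: x_j is the coordinate [lshift n j] and y_j the
   coordinate [rshift n j].  The library norm on matrices is the max norm; it
   is used only for its topology and differential calculus, and the Euclidean
   norm is [enorm]. *)
Notation R2n R n := 'cV[R]_(n + n).

Definition xc (R : realType) (n : nat) (z : R2n R n) (j : 'I_n) : R :=
  z (lshift n j) 0.
Definition yc (R : realType) (n : nat) (z : R2n R n) (j : 'I_n) : R :=
  z (rshift n j) 0.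

Definition enorm (R : realType) (m : nat) (z : 'cV[R]_m) : R :=
  Num.sqrt (\sum_(i < m) z i 0 ^+ 2).

Definition oball (R : realType) (n : nat) (r : R) : set (R2n R n) :=
  [set z | enorm z < r].
Definition cball (R : realType) (n : nat) (r : R) : set (R2n R n) :=
  [set z | enorm z <= r].
Arguments oball {R} n r.
Arguments cball {R} n r.

Definition omega0 (R : realType) (n : nat) (u v : R2n R n) : R :=
  \sum_(j < n) (xc u j * yc v j - yc u j * xc v j).

Definition form_norm (R : realType) (n : nat)
    (beta : R2n R n -> R2n R n -> R) : R :=
  Num.sqrt (\sum_(i < n + n) \sum_(j < n + n | (i < j)%N)
              beta (delta_mx i 0) (delta_mx j 0) ^+ 2).

(* A two-form on U is a function [beta z u v] of the base point z and of two
   tangent vectors u and v. *)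
Definition form_sup_norm (R : realType) (n : nat) (U : set (R2n R n))
    (beta : R2n R n -> R2n R n -> R2n R n -> R) : \bar R :=
  ereal_sup [set (form_norm (beta z))%:E | z in U].

Definition pullback (R : realType) (n : nat) (phi : R2n R n -> R2n R n)
    (z u v : R2n R n) : R :=
  omega0 ('d phi z u) ('d phi z v).

Definition eps_symplectic (R : realType) (n : nat) (eps : R)
    (U : set (R2n R n)) (phi : R2n R n -> R2n R n) : Prop :=
  (form_sup_norm U (fun z u v => (pullback phi z u v - omega0 u v)%R) <= eps%:E)%E.

Definition eps_anti_symplectic (R : realType) (n : nat) (eps : R)
    (U : set (R2n R n)) (phi : R2n R n -> R2n R n) : Prop :=
  (form_sup_norm U (fun z u v => (pullback phi z u v + omega0 u v)%R) <= eps%:E)%E.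

Fixpoint Ck (R : realType) (n k : nat) (U : set (R2n R n))
    (f : R2n R n -> R2n R n) : Prop :=
  match k with
  | 0%N => forall z, U z -> {for z, continuous f}
  | k'.+1 => (forall z, U z -> differentiable f z) /\
             (forall v, Ck k' U (fun z => 'D_v f z))
  end.

(* Smooth embedding of the open set U: a smooth immersion that is a
   homeomorphism onto its image, with inverse g.  Maps on U are represented by
   total functions whose values outside U are irrelevant. *)
Definition smooth_embedding (R : realType) (n : nat) (U : set (R2n R n))
    (phi : R2n R n -> R2n R n) : Prop :=
  [/\ forall k, Ck k U phi,
      forall z, U z -> injective ('d phi z) &
      exists g : R2n R n -> R2n R n,
        (forall z, U z -> g (phi z) = z) /\ {within phi @` U, continuous g}].

Definition symplectic_embedding (R : realType) (n : nat) (U : set (R2n R n))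
    (psi : R2n R n -> R2n R n) : Prop :=
  smooth_embedding U psi /\
  forall z, U z -> forall u v, pullback psi z u v = omega0 u v.

(* Z_1 = B_1^2 x R^{2n-2}, the disc being in the first coordinates (x_1, y_1),
   i.e. those of index 0; meaningful for n >= 1. *)
Definition cylinder1 (R : realType) (n : nat) : set (R2n R n) :=
  [set z | forall j : 'I_n, val j = 0%N -> xc z j ^+ 2 + yc z j ^+ 2 <= 1].
Arguments cylinder1 R n : clear implicits.

(* Normalization is stated with closed ball and cylinder; given monotonicity
   and conformality it is equivalent to the one with open ball and cylinder. *)
Record capacity (R : realType) (n : nat) (c : set (R2n R n) -> \bar R) : Prop :=
  Capacity {
    capacity_ge0 : forall U, (0 <= c U)%E ;
    capacity_monotone : forall (U V O : set (R2n R n)) psi,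
      open O -> U `<=` O -> symplectic_embedding O psi -> psi @` U `<=` V ->
      (c U <= c V)%E ;
    capacity_conformal : forall (a : R) (U : set (R2n R n)), a != 0 ->
      c [set a *: z | z in U] = ((a ^+ 2)%:E * c U)%E ;
    capacity_ball : c (cball n 1) = (pi : R)%:E ;
    capacity_cylinder : c (cylinder1 R n) = (pi : R)%:E
  }.

Definition ellipsoid (R : realType) (n : nat) (A : 'M[R]_(n + n)) :
  set (R2n R n) := [set A *m z | z in cball n 1].

Definition std_ellipsoid (R : realType) (n : nat) (r : 'I_n -> R) :
  set (R2n R n) :=
  [set z | \sum_(j < n) (xc z j ^+ 2 + yc z j ^+ 2) / r j ^+ 2 <= 1].

Definition linear_symplectic (R : realType) (n : nat)
    (Psi : {linear R2n R n -> R2n R n}) : Prop :=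
  forall u v, omega0 (Psi u) (Psi v) = omega0 u v.

Definition is_lin_width (R : realType) (n : nat) (E : set (R2n R n)) (w : R) :
    Prop :=
  (exists A : 'M[R]_(n + n), [/\ A \in unitmx, E = ellipsoid A &
     exists (Psi : {linear R2n R n -> R2n R n}) (r : 'I_n -> R),
       [/\ linear_symplectic Psi,
           forall j, 0 < r j,
           forall i j : 'I_n, (i <= j)%N -> r i <= r j,
           Psi @` E = std_ellipsoid r &
           exists2 j : 'I_n, val j = 0%N & w = r j]])
  \/ (exists A : 'M[R]_(n + n),
        [/\ A \notin unitmx, E = ellipsoid A & w = 0]).

(* The linear symplectic width as a function; the default value 0 is
   irrelevant for the ellipsoids (possibly degenerate) it is applied to. *)
Definition lin_width (R : realType) (n : nat) (E : set (R2n R n)) : R :=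
  xget 0 [set w | is_lin_width E w].

Definition opnorm (R : realType) (m : nat) (A : 'M[R]_m) : R :=
  sup [set enorm (A *m z) | z in [set z : 'cV[R]_m | enorm z <= 1]].

Definition rho (R : realType) (eps : R) : R := Num.sqrt (1 - eps).

(* The infimum is attained, so this is the smallest such radius. *)
Definition rad (R : realType) (n : nat) (A : 'M[R]_(n + n)) : R :=
  inf [set r : R | ellipsoid A `<=` cball n r].

Definition distortion (R : realType) (n : nat) (eps : R) (A : 'M[R]_(n + n)) :
  R := opnorm (invmx A) * ((rho eps)^-1 - 1) * rad A.

Definition s_ (R : realType) (n : nat) (eps : R) (A : 'M[R]_(n + n)) : R :=
  (1 + distortion eps A)^-1.

Definition e_ (R : realType) (n : nat) (eps : R) (A : 'M[R]_(n + n)) : R :=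
  (1 - distortion eps A)^-1.

Definition e_defined (R : realType) (n : nat) (eps : R) (A : 'M[R]_(n + n)) :
  Prop := distortion eps A < 1.

Definition lin_non_squeezing (R : realType) (n : nat) (eps : R)
    (Phi : {linear R2n R n -> R2n R n}) : Prop :=
  forall A : 'M[R]_(n + n), A \in unitmx ->
    s_ eps A * lin_width (ellipsoid A) <= lin_width (Phi @` ellipsoid A).

Definition lin_non_expanding (R : realType) (n : nat) (eps : R)
    (Phi : {linear R2n R n -> R2n R n}) : Prop :=
  (forall r : R, 0 < r -> lin_width (Phi @` cball n r) <= (rho eps)^-1 * r) /\
  (forall A : 'M[R]_(n + n), A \in unitmx -> e_defined eps A ->
     lin_width (Phi @` ellipsoid A) <= e_ eps A * lin_width (ellipsoid A)).

Definition preserves_capacity (R : realType) (n : nat)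
    (c : set (R2n R n) -> \bar R) (eps : R) (U : set (R2n R n))
    (phi : R2n R n -> R2n R n) : Prop :=
  forall (A : 'M[R]_(n + n)) (p : R2n R n), A \in unitmx ->
    let E := [set p + z | z in ellipsoid A] in
    E `<=` U ->
    ((s_ eps A ^+ 2)%:E * c E <= c (phi @` E))%E /\
    (e_defined eps A -> (c (phi @` E) <= (e_ eps A ^+ 2)%:E * c E)%E).

(* Main.v *)
Require Import Defs.
From HB Require Import structures.
From mathcomp Require Import all_boot all_order all_algebra.
From mathcomp Require Import all_classical all_reals all_analysis.
From mathcomp Require Import ring lra zify.

Set Implicit Arguments.
Unset Strict Implicit.
Unset Printing Implicit Defensive.

Import Order.TTheory GRing.Theory Num.Theory.
Import numFieldNormedType.Exports.

Local Open Scope classical_set_scope.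
Local Open Scope ring_scope.

(** Why the theorem holds.

    For an invertible matrix A the linear symplectic width w of the ellipsoid
    E(A) has an intrinsic description: w^-2 is the least lambda such that
    omega0 xi eta <= lambda |A^T xi| |A^T eta| for all xi and eta
    ([lin_width_boundP]).  Existence of w is Williamson's theorem
    ([williamson], [lin_width_ellipsoid]), obtained from the orthogonal normal
    form of a skew matrix; uniqueness holds because xi |-> |A^T xi| is the
    support function of E(A).

    Let M be an invertible linear map.  Since M E(A) = E(M A), comparing the
    widths of E(A) and M E(A) amounts to comparing omega0 with the form
    Q(xi, eta) = omega0 (M^-T xi) (M^-T eta), read through A^-1.  For
    orthonormal c1 and c2 choose A such that A^-1 is the identity on the plane
    of c1 and c2 and delta times the identity on its orthogonal complement.
    Then up to O(delta) only omega0 c1 c2 and Q(c1, c2) are left in the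
    comparison ([squeeze_form]).  The condition number of A is at most
    1 / delta, so the distortion of A is at most eps / delta.  With
    delta = sqrt eps both errors are O(sqrt eps), hence
    | |Q(c1, c2)| - |omega0 c1 c2| | <= 5 delta ([dual_form_orthonormal]).
    Pairs of basis vectors determine Q up to signs; the pairs
    (e_i + e_k, f_i + f_k) show that the signs agree ([dual_form_sign]).  So
    Q is close to omega0 or to - omega0, and inverting gives the same for
    M^* omega0, with K(eps) = 80 n^3 sqrt eps ([symplectic_or_anti]).

    For an embedding phi and a capacity c, the normal form puts E(A) between a
    ball and a cylinder of radius w, so c takes the value pi w^2 on every
    translate of E(A) ([capacity_ellipsoid]).  Because phi is strictly
    differentiable at p, the image of a small ellipsoid centered at p lies
    between the dilations by 1 - q and 1 + q of its image under the
    differential, with q arbitrarily small; the inner inclusion is a fixed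
    point argument ([image_small_ellipsoid]).  Letting q tend to 0, the
    differential of phi at p satisfies the width estimates that a linear map
    is assumed to satisfy, and it is K(eps)-symplectic or
    K(eps)-anti-symplectic.  As K(eps) < 1, a continuity argument along rays
    from the origin shows that the alternative does not depend on p
    ([same_alternative]). *)

(** * Euclidean and symplectic linear algebra *)

Section Euclidean.
Variables (R : realType) (m : nat).
Implicit Types (x y z : 'cV[R]_m) (a : R).

Definition dot x y : R := (x^T *m y) 0 0.

Lemma dotE x y : dot x y = \sum_i x i 0 * y i 0.
Proof. by rewrite /dot mxE; apply: eq_bigr => i _; rewrite mxE. Qed.

Lemma dotC x y : dot x y = dot y x.
Proof. by rewrite !dotE; apply: eq_bigr => i _; rewrite mulrC. Qed.

Lemma dotDr x y z : dot x (y + z) = dot x y + dot x z.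
Proof. by rewrite /dot mulmxDr mxE. Qed.

Lemma dotDl x y z : dot (y + z) x = dot y x + dot z x.
Proof. by rewrite dotC dotDr !(dotC x). Qed.

Lemma dotZr x y a : dot x (a *: y) = a * dot x y.
Proof. by rewrite /dot -scalemxAr mxE. Qed.

Lemma dotZl x y a : dot (a *: y) x = a * dot y x.
Proof. by rewrite dotC dotZr dotC. Qed.

Lemma dotNr x y : dot x (- y) = - dot x y.
Proof. by rewrite -scaleN1r dotZr mulN1r. Qed.

Lemma dotNl x y : dot (- y) x = - dot y x.
Proof. by rewrite dotC dotNr dotC. Qed.

Lemma dotBr x y z : dot x (y - z) = dot x y - dot x z.
Proof. by rewrite dotDr dotNr. Qed.

Lemma dotBl x y z : dot (y - z) x = dot y x - dot z x.
Proof. by rewrite dotDl dotNl. Qed.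

Lemma dot0r x : dot x 0 = 0.
Proof. by rewrite /dot mulmx0 mxE. Qed.

Lemma dot0l x : dot 0 x = 0.
Proof. by rewrite dotC dot0r. Qed.

Lemma dot_delta i x : dot (delta_mx i 0) x = x i 0.
Proof.
rewrite dotE (bigD1 i) //= mxE !eqxx mul1r big1 ?addr0 // => j /negPf ji.
by rewrite mxE ji mul0r.
Qed.

Lemma dot_delta_delta (i j : 'I_m) :
  dot (delta_mx i 0) (delta_mx j 0) = (i == j)%:R.
Proof. by rewrite dot_delta mxE eqxx andbT. Qed.

Lemma dot_ge0 x : 0 <= dot x x.
Proof. by rewrite dotE sumr_ge0 // => i _; rewrite -expr2 sqr_ge0. Qed.

Lemma enormE x : enorm x = Num.sqrt (dot x x).
Proof. by rewrite /enorm dotE; under eq_bigr do rewrite expr2. Qed.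

Lemma enorm_ge0 x : 0 <= enorm x.
Proof. exact: sqrtr_ge0. Qed.

Lemma enorm_sqr x : enorm x ^+ 2 = dot x x.
Proof. by rewrite enormE sqr_sqrtr // dot_ge0. Qed.

Lemma dot_eq0 x : (dot x x == 0) = (x == 0).
Proof.
apply/idP/eqP => [|->]; last by rewrite dot0r.
rewrite dotE psumr_eq0; last by move=> i _; rewrite -expr2 sqr_ge0.
move=> /allP h; apply/matrixP => i j; rewrite ord1 mxE; apply/eqP.
by rewrite -sqrf_eq0 expr2; apply: h; rewrite mem_index_enum.
Qed.

Lemma enorm_eq0 x : (enorm x == 0) = (x == 0).
Proof. by rewrite -dot_eq0 -enorm_sqr sqrf_eq0. Qed.

Lemma enorm_gt0 x : (0 < enorm x) = (x != 0).
Proof. by rewrite lt_neqAle enorm_ge0 andbT eq_sym enorm_eq0. Qed.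

Lemma enorm0 : enorm (0 : 'cV[R]_m) = 0.
Proof. by apply/eqP; rewrite enorm_eq0. Qed.

Lemma enormZ a x : enorm (a *: x) = `|a| * enorm x.
Proof.
by rewrite !enormE dotZl dotZr mulrA -expr2 sqrtrM ?sqr_ge0 // sqrtr_sqr.
Qed.

Lemma enormN x : enorm (- x) = enorm x.
Proof. by rewrite -scaleN1r enormZ normrN normr1 mul1r. Qed.

Lemma enorm_le x a : 0 <= a -> (enorm x <= a) = (dot x x <= a ^+ 2).
Proof. by move=> a0; rewrite -enorm_sqr ler_sqr ?nnegrE ?enorm_ge0. Qed.

Lemma enorm_leP x y : (enorm x <= enorm y) = (dot x x <= dot y y).
Proof. by rewrite enorm_le ?enorm_ge0 // enorm_sqr. Qed.

Lemma enorm_inj x y : dot x x = dot y y -> enorm x = enorm y.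
Proof. by rewrite !enormE => ->. Qed.

Lemma dot_cauchy x y : `|dot x y| <= enorm x * enorm y.
Proof.
have [->|x0] := eqVneq x 0; first by rewrite dot0l normr0 enorm0 mul0r.
rewrite -ler_sqr ?nnegrE ?mulr_ge0 ?enorm_ge0 // real_normK ?num_real //.
rewrite exprMn !enorm_sqr.
have xx : 0 < dot x x by rewrite lt_neqAle dot_ge0 andbT eq_sym dot_eq0.
have := dot_ge0 (dot x x *: y - dot x y *: x).
rewrite !(dotBl, dotBr, dotZl, dotZr) (dotC y x) => h.
have : 0 <= dot x x * (dot x x * dot y y - dot x y ^+ 2).
  by move: h; congr (_ <= _); ring.
by rewrite pmulr_rge0 // subr_ge0.
Qed.

Lemma dot_le x y : dot x y <= enorm x * enorm y.
Proof. exact: le_trans (ler_norm _) (dot_cauchy _ _). Qed.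

Lemma enormD x y : enorm (x + y) <= enorm x + enorm y.
Proof.
rewrite enorm_le ?addr_ge0 ?enorm_ge0 // sqrrD !enorm_sqr dotDl !dotDr.
by rewrite (dotC y x); have := dot_le x y; lra.
Qed.

Lemma enormB x y : enorm (x - y) <= enorm x + enorm y.
Proof. by rewrite -(enormN y) enormD. Qed.

Lemma enorm_coord x i : `|x i 0| <= enorm x.
Proof.
rewrite -ler_sqr ?nnegrE ?enorm_ge0 // real_normK ?num_real // enorm_sqr dotE.
by rewrite (bigD1 i) //= -expr2 lerDl sumr_ge0 // => j _; rewrite -expr2 sqr_ge0.
Qed.

Lemma enorm_le_sum x : enorm x <= \sum_i `|x i 0|.
Proof.
rewrite enorm_le ?sumr_ge0 // dotE expr2 mulr_suml.
apply: ler_sum => i _; rewrite -expr2 -[leLHS]real_normK ?num_real // expr2.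
by rewrite ler_wpM2l // (bigD1 i) //= lerDl sumr_ge0.
Qed.

End Euclidean.

Lemma dot_mul (R : realType) m p (A : 'M[R]_(m, p)) x y :
  dot x (A *m y) = dot (A^T *m x) y.
Proof. by rewrite /dot trmx_mul trmxK mulmxA. Qed.

Lemma dot_mull (R : realType) m p (A : 'M[R]_(m, p)) x y :
  dot (A *m y) x = dot y (A^T *m x).
Proof. by rewrite dotC dot_mul dotC. Qed.

Lemma enorm_orthogonal (R : realType) m (U : 'M[R]_m) x :
  U^T *m U = 1%:M -> enorm (U *m x) = enorm x.
Proof. by move=> UU; apply: enorm_inj; rewrite dot_mul mulmxA UU mul1mx. Qed.

Lemma kernel_wide (R : realType) m p (A : 'M[R]_(m, p)) :
  (m < p)%N -> exists2 x : 'cV[R]_p, x != 0 & A *m x = 0.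
Proof.
move=> mp; have : kermx A^T != 0.
  rewrite -mxrank_eq0 mxrank_ker -lt0n subn_gt0.
  by rewrite (leq_ltn_trans _ mp) // mxrank_tr rank_leq_row.
case/rowV0Pn => v /sub_kermxP vA v0; exists v^T.
  by rewrite -(inj_eq (@trmx_inj _ _ _)) trmxK trmx0.
by apply: trmx_inj; rewrite trmx_mul trmxK vA trmx0.
Qed.

Lemma kernel_singular (R : realType) m (A : 'M[R]_m) :
  A \notin unitmx -> exists2 x : 'cV[R]_m, x != 0 & A *m x = 0.
Proof.
rewrite -unitmx_tr -row_free_unit -kermx_eq0 => /rowV0Pn[v /sub_kermxP vA v0].
exists v^T; first by rewrite -(inj_eq (@trmx_inj _ _ _)) trmxK trmx0.
by apply: trmx_inj; rewrite trmx_mul trmxK vA trmx0.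
Qed.

Section Symplectic.
Variables (R : realType) (n : nat).
Implicit Types (u v : R2n R n) (M : 'M[R]_(n + n)).

Definition Jmx : 'M[R]_(n + n) := block_mx 0 1%:M (- 1%:M) 0.

Lemma tr_Jmx : Jmx^T = - Jmx.
Proof.
by rewrite tr_block_mx opp_block_mx !trmx0 linearN /= trmx1 !oppr0 opprK.
Qed.

Lemma Jmx_sqr : Jmx *m Jmx = - 1%:M.
Proof.
rewrite mulmx_block !mul0mx !mulmx0 !add0r !addr0 mul1mx mulmx1.
by rewrite scalar_mx_block opp_block_mx !oppr0.
Qed.

Lemma omega0E u v : omega0 u v = dot u (Jmx *m v).
Proof.
rewrite -{2}[v]vsubmxK /Jmx mul_block_col !mul0mx !mul1mx add0r addr0 mulNmx.
rewrite mul1mx dotE big_split_ord /= -big_split; apply: eq_bigr => j _ /=.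
by rewrite /xc /yc col_mxEu col_mxEd !mxE; ring.
Qed.

Lemma omega0C u v : omega0 u v = - omega0 v u.
Proof. by rewrite !omega0E dot_mul tr_Jmx mulNmx dotNl dotC. Qed.

Lemma omega0_Jl u v : omega0 (Jmx *m u) v = dot u v.
Proof.
by rewrite omega0E dot_mull tr_Jmx mulmxA mulNmx Jmx_sqr opprK mul1mx.
Qed.

Lemma enorm_Jmx u : enorm (Jmx *m u) = enorm u.
Proof.
by apply: enorm_orthogonal; rewrite tr_Jmx mulNmx Jmx_sqr opprK.
Qed.

Lemma omega0_le u v : `|omega0 u v| <= enorm u * enorm v.
Proof. by rewrite omega0E -(enorm_Jmx v) dot_cauchy. Qed.

Definition symplectic_mx M := M^T *m Jmx *m M = Jmx.

Lemma omega0_symplectic M u v :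
  symplectic_mx M -> omega0 (M *m u) (M *m v) = omega0 u v.
Proof. by move=> sM; rewrite !omega0E dot_mull !mulmxA sM. Qed.

Lemma symplectic_mxP M :
  (forall u v, omega0 (M *m u) (M *m v) = omega0 u v) -> symplectic_mx M.
Proof.
move=> h; apply/matrixP => i j.
have := h (delta_mx i 0) (delta_mx j 0).
by rewrite !omega0E dot_mull !mulmxA -colE -colE !dot_delta !mxE.
Qed.

Lemma symplectic_mx_inv M : symplectic_mx M ->
  M \in unitmx /\ symplectic_mx (invmx M).
Proof.
move=> sM.
have MM : (- Jmx *m M^T *m Jmx) *m M = 1%:M.
  by rewrite -!mulmxA (mulmxA M^T) sM mulNmx Jmx_sqr opprK.
have [_ uM] := mulmx1_unit MM; split=> //.
rewrite /symplectic_mx -{1}sM !mulmxA -trmx_mul mulmxV // trmx1 mul1mx.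
by rewrite -mulmxA mulmxV // mulmx1.
Qed.

Lemma symplectic_mx_tr M : symplectic_mx M -> symplectic_mx M^T.
Proof.
move=> sM; have [uM _] := symplectic_mx_inv sM.
have MM : (- Jmx *m M^T *m Jmx) *m M = 1%:M.
  by rewrite -!mulmxA (mulmxA M^T) sM mulNmx Jmx_sqr opprK.
have h : M *m Jmx *m M^T *m Jmx = - 1%:M.
  by rewrite -(mulmx1C MM) !mulNmx mulmxN opprK !mulmxA.
have : M *m Jmx *m M^T *m Jmx *m Jmx = - Jmx by rewrite h mulNmx mul1mx.
by rewrite -mulmxA Jmx_sqr mulmxN mulmx1 => /oppr_inj; rewrite /symplectic_mx trmxK.
Qed.

End Symplectic.
Arguments Jmx {R n}.

Lemma linear_cV_sum (R : realType) m (W : lmodType R) (f : {linear 'cV[R]_m -> W}) u :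
  f u = \sum_j u j 0 *: f (delta_mx j 0).
Proof.
rewrite [in LHS](matrix_sum_delta u) linear_sum /=; apply: eq_bigr => j _.
by rewrite big_ord1 linearZ.
Qed.

Lemma linear_cV_mx (R : realType) m p (f : {linear 'cV[R]_m -> 'cV[R]_p}) :
  exists M : 'M[R]_(p, m), forall u, f u = M *m u.
Proof.
exists (\matrix_(i, j) f (delta_mx j 0) i 0) => u; rewrite linear_cV_sum.
apply/matrixP => i j; rewrite !ord1 summxE mxE; apply: eq_bigr => k _.
by rewrite !mxE mulrC.
Qed.

(** * Normal form of skew matrices and Williamson's theorem *)

Lemma mx_norm_coord (R : realType) m p (x : 'M[R]_(m, p)) i j : `|x i j| <= `|x|.
Proof.
rewrite [leRHS]/Num.Def.normr /= mx_normrE.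
by apply/bigmax_geP; right; exists (i, j).
Qed.

Lemma mx_norm_le (R : realType) m p (x : 'M[R]_(m, p)) a :
  0 <= a -> (forall i j, `|x i j| <= a) -> `|x| <= a.
Proof.
move=> a0 h; rewrite [leLHS]/Num.Def.normr /= mx_normrE.
by apply/bigmax_leP; split=> // -[i j] _; exact: h.
Qed.

Lemma norm_le_enorm (R : realType) m (x : 'cV[R]_m) : `|x| <= enorm x.
Proof.
by apply: mx_norm_le => [|i j]; rewrite ?enorm_ge0 // ord1 enorm_coord.
Qed.

Lemma enorm_le_norm (R : realType) m (x : 'cV[R]_m) : enorm x <= m%:R * `|x|.
Proof.
apply: le_trans (enorm_le_sum x) _.
rewrite -[X in X%:R]card_ord -sum1_card natr_sum mulr_suml.
by apply: ler_sum => i _; rewrite mul1r mx_norm_coord.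
Qed.

Lemma dot_normalize (R : realType) m (x : 'cV[R]_m) :
  x != 0 -> dot ((enorm x)^-1 *: x) ((enorm x)^-1 *: x) = 1.
Proof.
move=> x0; rewrite dotZl dotZr -enorm_sqr mulrA -expr2 exprVn mulVf //.
by rewrite expf_neq0 // enorm_eq0.
Qed.

Lemma continuous_sum (R : realType) (T : topologicalType) m
    (f : 'I_m -> T -> R) :
  (forall i, continuous (f i)) -> continuous (fun x => \sum_i f i x).
Proof.
move=> h; apply: continuous_big => //.
exact: pseudometric_normed_Zmodule.add_continuous.
Qed.

Lemma continuous_mulmx_tr (R : realType) m p (A : 'M[R]_(m, p)) i :
  continuous (fun x : 'rV[R]_p => (A *m x^T) i 0).
Proof.
rewrite (_ : (fun _ => _) = fun x : 'rV[R]_p => \sum_j A i j * x 0 j); last first.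
  by apply/funext => x; rewrite mxE; apply: eq_bigr => j _; rewrite mxE.
apply: continuous_sum => j x.
apply: (@continuousM _ _ (fun=> A i j) (fun y : 'rV[R]_p => y 0 j) x).
  exact: cst_continuous.
exact: coord_continuous.
Qed.

Lemma continuous_dot_tr (R : realType) m p (A : 'M[R]_(m, p)) :
  continuous (fun x : 'rV[R]_p => dot (A *m x^T) (A *m x^T)).
Proof.
rewrite (_ : (fun _ => _) =
   fun x : 'rV[R]_p => \sum_i (A *m x^T) i 0 * (A *m x^T) i 0); last first.
  by apply/funext => x; rewrite dotE.
apply: continuous_sum => i x.
by apply: (@continuousM _ _ (fun y : 'rV[R]_p => (A *m y^T) i 0)
  (fun y : 'rV[R]_p => (A *m y^T) i 0)); exact: continuous_mulmx_tr.
Qed.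

Lemma closed_level (R : realType) (T : topologicalType) (f : T -> R) a :
  continuous f -> closed [set x | f x = a].
Proof.
move=> cf; rewrite (_ : [set _ | _] = f @^-1` [set y | y = a]) //.
by apply: preimage_closed => [x _|]; [exact: cf | exact: closed_eq].
Qed.

(** The unit vectors of a kernel form a compact set, on which the quadratic
    function |T x|^2 is continuous.  The kernel encodes the orthogonal complement
    of finitely many vectors. *)
Lemma max_on_kernel_sphere (R : realType) m p (K : 'M[R]_(p, m)) (T : 'M[R]_m) :
  (exists2 x : 'cV[R]_m, x != 0 & K *m x = 0) ->
  exists v : 'cV[R]_m, [/\ enorm v = 1, K *m v = 0 &
    forall x, K *m x = 0 -> enorm (T *m x) <= enorm (T *m v) * enorm x].
Proof.
move=> [x x0 Kx].
pose A := [set y : 'rV[R]_m | dot (1%:M *m y^T) (1%:M *m y^T) = 1] `&`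
          [set y : 'rV[R]_m | dot (K *m y^T) (K *m y^T) = 0].
have clA : closed A.
  by apply: closedI; apply: closed_level; exact: continuous_dot_tr.
have bdA : bounded_set A.
  exists 1; split=> [|M M1 y [/= yy _]]; first exact: num_real.
  apply: le_trans (ltW M1); apply: mx_norm_le => // i j; rewrite ord1.
  have := enorm_coord y^T j; rewrite mxE => /le_trans; apply.
  by rewrite enorm_le // expr1n; move: yy; rewrite mul1mx => ->.
have nA : A !=set0.
  exists ((enorm x)^-1 *: x)^T; split => /=; rewrite trmxK.
    by rewrite mul1mx dot_normalize.
  by rewrite -scalemxAr Kx scaler0 dot0r.
have [y yA ymax] := EVT_max_rV nA (bounded_closed_compact bdA clA)
  (continuous_subspaceT (continuous_dot_tr (A := T))).
move: yA; rewrite inE => -[/=]; rewrite mul1mx => yy /eqP.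
rewrite dot_eq0 => /eqP Ky; exists y^T.
split=> // [|z Kz]; first by rewrite enormE yy sqrtr1.
have [->|z0] := eqVneq z 0; first by rewrite mulmx0 enorm0 mulr0.
have nz : 0 < enorm z by rewrite enorm_gt0.
have : enorm (T *m ((enorm z)^-1 *: z)) <= enorm (T *m y^T).
  rewrite enorm_leP; have := ymax ((enorm z)^-1 *: z)^T; rewrite trmxK; apply.
  rewrite inE; split => /=; rewrite trmxK.
    by rewrite mul1mx dot_normalize.
  by rewrite -scalemxAr Kz scaler0 dot0r.
rewrite -scalemxAr enormZ ger0_norm ?invr_ge0 ?enorm_ge0 // mulrC.
by rewrite ler_pdivrMr.
Qed.

(** First-order condition: comparing v with v + t w, the linear term in t has
    to vanish. *)
Lemma max_first_order (R : realType) m p (K : 'M[R]_(p, m)) (T : 'M[R]_m) v l :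
  enorm v = 1 -> K *m v = 0 -> enorm (T *m v) = l ->
  (forall x, K *m x = 0 -> enorm (T *m x) <= l * enorm x) ->
  forall w, K *m w = 0 -> dot (T *m v) (T *m w) = l ^+ 2 * dot v w.
Proof.
move=> v1 Kv Tv h w Kw.
have l0 : 0 <= l by rewrite -Tv enorm_ge0.
set b := dot (T *m v) (T *m w) - l ^+ 2 * dot v w.
pose c := dot (T *m w) (T *m w) - l ^+ 2 * dot w w.
have key t : 2 * t * b + t ^+ 2 * c <= 0.
  have /h : K *m (v + t *: w) = 0 by rewrite mulmxDr -scalemxAr Kv Kw scaler0 addr0.
  rewrite enorm_le ?mulr_ge0 ?enorm_ge0 // exprMn enorm_sqr mulmxDr -scalemxAr.
  rewrite !(dotDl, dotDr, dotZl, dotZr) -!(enorm_sqr v) -(enorm_sqr (T *m v)).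
  rewrite Tv v1 (dotC w v) (dotC (T *m w) (T *m v)) -subr_le0.
  by congr (_ <= 0); rewrite /b /c; ring.
apply/eqP; rewrite -subr_eq0 -/b; apply/negPn/negP => b0.
have c0 : c <= 0.
  by rewrite /c subr_le0 -!enorm_sqr -exprMn ler_sqr ?nnegrE ?mulr_ge0
    ?enorm_ge0 ?h.
(* At t = b / (1 - c) the value is b^2 (2 - c) / (1 - c)^2 > 0. *)
have := key (b / (1 - c)).
have c1 : 0 < 1 - c by lra.
have -> : 2 * (b / (1 - c)) * b + (b / (1 - c)) ^+ 2 * c =
  (b / (1 - c)) ^+ 2 * (2 - c) by field; rewrite gt_eqF.
rewrite pmulr_lle0; last by lra.
rewrite exprn_even_le0 //= mulf_eq0 (negPf b0) invr_eq0 /=.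
by apply/negP; rewrite gt_eqF.
Qed.

Section SkewNormalForm.
Variables (R : realType) (n : nat) (S : 'M[R]_(n + n)).
Hypotheses (skS : S^T = - S) (unS : S \in unitmx).

Lemma skew_dot x y : dot x (S *m y) = - dot (S *m x) y.
Proof. by rewrite dot_mul skS mulNmx dotNl. Qed.

(** Normal planes are split off one at a time: the direction v maximising |S v|
    on the orthogonal complement of the previous planes is an eigenvector of
    S^T S, so v and S v span an invariant plane.  The last clause records that
    the successive maxima decrease. *)
Lemma skew_planes k : (k <= n)%N ->
  exists (u v : nat -> 'cV[R]_(n + n)) (l : nat -> R),
    [/\ forall i, (i < k)%N ->
          [/\ 0 < l i, S *m v i = l i *: u i & S *m u i = - l i *: v i],
        forall i j, (i < k)%N -> (j < k)%N ->
          [/\ dot (u i) (u j) = (i == j)%:R, dot (v i) (v j) = (i == j)%:R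
            & dot (u i) (v j) = 0] &
        forall i, (i < k)%N -> forall x,
          (forall j, (j < i)%N -> dot (u j) x = 0 /\ dot (v j) x = 0) ->
          enorm (S *m x) <= l i * enorm x].
Proof.
elim: k => [|k IH] kn; first by exists (fun=> 0), (fun=> 0), (fun=> 0).
have [u [v [l [huv ho hm]]]] := IH (ltnW kn).
pose K := \matrix_(i < k + k) (match fintype.split i with
  | inl j => (u j)^T | inr j => (v j)^T end).
have KP x : K *m x = 0 <->
    forall j, (j < k)%N -> dot (u j) x = 0 /\ dot (v j) x = 0.
  have Ki i : (K *m x) i 0 = match fintype.split i with
      | inl j => dot (u j) x | inr j => dot (v j) x end.
    rewrite mxE; under eq_bigr do rewrite mxE.
    by case: (fintype.split i) => j; rewrite dotE; apply: eq_bigr => a _; rewrite mxE.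
  split=> [Kx j jk|h].
    split.
      have := Ki (lshift k (Ordinal jk)); rewrite Kx mxE.
      by rewrite -[lshift _ _]/(unsplit (inl (Ordinal jk))) unsplitK.
    have := Ki (rshift k (Ordinal jk)); rewrite Kx mxE.
    by rewrite -[rshift _ _]/(unsplit (inr (Ordinal jk))) unsplitK.
  apply/matrixP => i j; rewrite ord1 Ki mxE; case: (fintype.split i) => a.
    by have [] := h a (ltn_ord a).
  by have [] := h a (ltn_ord a).
have [|w [w1 Kw wmax]] := max_on_kernel_sphere (K := K) S.
  by apply: kernel_wide; lia.
have [m mE] : {m | m = enorm (S *m w)} by exists (enorm (S *m w)).
rewrite -mE in wmax.
have m0 : 0 < m.
  rewrite mE enorm_gt0; apply/eqP => Sw.
  have : w = 0 by rewrite -[w]mul1mx -(mulVmx unS) -mulmxA Sw mulmx0.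
  by move=> w0; move: w1; rewrite w0 enorm0; lra.
have [z zE] : {z | z = m^-1 *: (S *m w)} by exists (m^-1 *: (S *m w)).
have KS (x : R2n R n) : K *m x = 0 -> K *m (S *m x) = 0.
  move=> /(proj1 (KP x)) h; apply: (proj2 (KP _)) => j jk; have [_ Sv Su] := huv j jk.
  by rewrite !skew_dot Sv Su !dotZl (h j jk).1 (h j jk).2 !mulr0 oppr0.
have Kz : K *m z = 0 by rewrite zE -scalemxAr KS // scaler0.
have Sw : S *m w = m *: z by rewrite zE scalerA mulfV ?scale1r // gt_eqF.
have Sz : S *m z = - m *: w.
  have KSz : K *m (S *m z + m *: w) = 0.
    by rewrite mulmxDr KS // -(scalemxAr m K w) Kw scaler0 addr0.
  suff : S *m z + m *: w = 0 by move/eqP; rewrite addr_eq0 scaleNr => /eqP.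
  apply/eqP; rewrite -dot_eq0; 
  have [y yE] : {y | y = S *m z + m *: w} by exists (S *m z + m *: w).
  rewrite -yE in KSz *.
  have := max_first_order w1 Kw (esym mE) wmax KSz.
  rewrite Sw skew_dot => e.
  rewrite {1}yE dotDl dotZl.
  have /eqP := e; rewrite -(scalemxAr m S z) dotZl -subr_eq0 => /eqP e'.
  apply/eqP; have mn0 : m != 0 by rewrite gt_eqF.
  apply: (mulfI mn0).
  by rewrite mulr0; apply: oppr_inj; rewrite oppr0 -[RHS]e'; ring.
have zz : dot z z = 1.
  by rewrite zE mE dot_normalize // -enorm_gt0 -mE.
have ww : dot w w = 1 by rewrite -enorm_sqr w1 expr1n.
have zw : dot z w = 0.
  have : dot w (m *: z) = 0 by rewrite -Sw; have := skew_dot w w; rewrite (dotC (S *m w)); lra.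
  by rewrite dotZr dotC => /eqP; rewrite mulf_eq0 gt_eqF //= => /eqP.
have [hw hz] := (proj1 (KP w) Kw, proj1 (KP z) Kz).
exists (fun i => if i == k then z else u i), (fun i => if i == k then w else v i),
  (fun i => if i == k then m else l i); split.
- move=> i; rewrite ltnS leq_eqVlt; case: eqVneq => [_ _|_ ik]; first by split.
  exact: huv.
- clear KP Kw Kz KS wmax zE Sw Sz.
  move=> i j; rewrite !ltnS (leq_eqVlt i) (leq_eqVlt j).
  case: (eqVneq i k) => [->|ik]; case: (eqVneq j k) => [->|jk]; rewrite ?orTb ?orFb.
  + by [].
  + move=> _ jl; have [h1 h2] := hz _ jl; have [h3 h4] := hw _ jl.
    by split; rewrite // dotC.
  + move=> il _; have [h1 h2] := hz _ il; have [h3 h4] := hw _ il.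
    by rewrite (negPf ik); split.
  + by move=> il jl; have := ho _ _ il jl.
- move=> i; rewrite ltnS leq_eqVlt; case: (eqVneq i k) => [-> _|ik ilt] x hx.
    apply: wmax; apply: (KP x).2 => j jk.
    by move: (hx j jk); rewrite (ltn_eqF jk).
  apply: hm => // j ji.
  by move: (hx j ji); rewrite (ltn_eqF (ltn_trans ji ilt)).
Qed.

End SkewNormalForm.

Section Columns.
Variables (R : realType) (m k : nat).
Implicit Types f g : 'I_k -> 'cV[R]_m.

Definition cols f : 'M[R]_(m, k) := \matrix_(i, j) f j i 0.

Lemma tr_cols_mul f g i j : ((cols f)^T *m cols g) i j = dot (f i) (g j).
Proof. by rewrite mxE dotE; apply: eq_bigr => a _; rewrite !mxE. Qed.

Lemma mul_cols (S : 'M[R]_m) f : S *m cols f = cols (fun j => S *m f j).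
Proof.
by apply/matrixP => i j; rewrite !mxE; apply: eq_bigr => a _; rewrite mxE.
Qed.

Lemma cols_diag f (d : 'I_k -> R) :
  cols f *m diag_mx (\row_j d j) = cols (fun j => d j *: f j).
Proof. by apply/matrixP => i j; rewrite mul_mx_diag !mxE mulrC. Qed.

End Columns.

Definition polydiag (R : realType) n (r : 'I_n -> R) : 'M[R]_(n + n) :=
  block_mx (diag_mx (\row_j r j)) 0 0 (diag_mx (\row_j r j)).

(** Williamson's normal form.  With C = A^-1 the matrix C J C^T is skew; the
    orthogonal matrix U bringing it to normal form, rescaled by D to have
    entries 1, turns D U^T C into a symplectic matrix mapping E(A) to D B. *)
Lemma williamson (R : realType) (n : nat) (A : 'M[R]_(n + n)) : A \in unitmx ->
  exists (Psi : 'M[R]_(n + n)) (r : 'I_n -> R) (U : 'M[R]_(n + n)),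
    [/\ symplectic_mx Psi, forall j, 0 < r j,
        forall i j : 'I_n, (i <= j)%N -> r i <= r j,
        U^T *m U = 1%:M &
        Psi *m A = polydiag r *m U].
Proof.
move=> uA; set C := invmx A.
pose S := C *m Jmx *m C^T.
have skS : S^T = - S.
  by rewrite !trmx_mul trmxK tr_Jmx mulNmx mulmxN mulmxA.
have unJ : (Jmx : 'M[R]_(n + n)) \in unitmx.
  have /mulmx1_unit[] // : - Jmx *m Jmx = 1%:M :> 'M[R]_(n + n).
  by rewrite mulNmx Jmx_sqr opprK.
have unS : S \in unitmx by rewrite !unitmx_mul unitmx_tr unitmx_inv uA unJ.
have [u [v [l [huv ho hm]]]] := skew_planes skS unS (leqnn n).
pose lo (j : 'I_n) := l j.
pose uo (j : 'I_n) := u j.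
pose vo (j : 'I_n) := v j.
pose W := row_mx (cols uo) (cols vo).
have WW : W^T *m W = 1%:M.
  rewrite tr_row_mx mul_col_row scalar_mx_block; congr block_mx;
  by apply/matrixP => i j; rewrite tr_cols_mul !mxE; have [] := ho i j (ltn_ord _) (ltn_ord _);
    have [] := ho j i (ltn_ord _) (ltn_ord _); rewrite // (dotC (vo i)).
have lo0 j : 0 < lo j by have [] := huv j (ltn_ord j).
have SW : W^T *m S *m W =
    block_mx 0 (diag_mx (\row_j lo j)) (- diag_mx (\row_j lo j)) 0.
  set B := block_mx _ _ _ _; suff SWB : S *m W = W *m B.
    by rewrite -mulmxA SWB mulmxA WW mul1mx.
  rewrite mul_mx_row mul_row_block !mulmx0 add0r addr0 mulmxN !cols_diag !mul_cols.
  congr row_mx; apply/matrixP => i j; rewrite [LHS]mxE; have [_ Sv Su] := huv j (ltn_ord j).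
    by rewrite /uo Su !mxE mulNr.
  by rewrite /vo Sv !mxE.
pose r j := (Num.sqrt (lo j))^-1.
have r0 j : 0 < r j by rewrite invr_gt0 sqrtr_gt0.
have WW' := mulmx1C WW.
exists (polydiag r *m W^T *m C), r, W^T; split=> //; last first.
- by rewrite -!mulmxA mulVmx // mulmx1.
- by rewrite trmxK.
- move=> i j ij; rewrite lef_pV2 ?posrE ?sqrtr_gt0 //.
  rewrite ler_psqrt ?nnegrE ?(ltW (lo0 _)) //.
  have [_ Svj _] := huv j (ltn_ord j).
  have [ujj vjj _] := ho j j (ltn_ord j) (ltn_ord j).
  have := hm i (ltn_ord i) (v j); rewrite Svj enormZ !enormE ujj vjj eqxx.
  rewrite sqrtr1 !mulr1 gtr0_norm; last exact: lo0.
  apply=> a ai.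
  have [_ h1 _] := ho a j (ltn_trans ai (ltn_ord i)) (ltn_ord j).
  have [_ _ h2] := ho a j (ltn_trans ai (ltn_ord i)) (ltn_ord j).
  by rewrite h1 h2 ltn_eqF // (leq_trans ai ij).
- rewrite -[polydiag r *m _ *m _]trmxK; apply: symplectic_mx_tr.
  have trD : (polydiag r)^T = polydiag r.
    by rewrite /polydiag tr_block_mx !trmx0 !tr_diag_mx.
  rewrite /symplectic_mx trmxK !trmx_mul trmxK trD.
  transitivity (polydiag r *m (W^T *m S *m W) *m polydiag r).
    by rewrite /S !mulmxA.
  rewrite SW /polydiag !mulmx_block !(mul0mx, mulmx0, add0r, addr0, mulNmx, mulmxN).
  have rlr : diag_mx (\row_j r j) *m diag_mx (\row_j lo j) *m
      diag_mx (\row_j r j) = 1%:M.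
    rewrite !mulmx_diag -diag_const_mx; congr diag_mx; apply/matrixP => i j.
    rewrite !mxE /r mulrAC -expr2 exprVn sqr_sqrtr ?(ltW (lo0 _)) // mulVf // gt_eqF //.
  by rewrite rlr.
Qed.

(** * The linear symplectic width *)

Section Ellipsoids.
Variables (R : realType) (n : nat).
Implicit Types (A B M U : 'M[R]_(n + n)) (r : 'I_n -> R).

Lemma image_ellipsoid (Phi : {linear R2n R n -> R2n R n}) M A :
  (forall u, Phi u = M *m u) -> Phi @` ellipsoid A = ellipsoid (M *m A).
Proof.
move=> h; apply/seteqP; split.
  by move=> _ [_ [x xB <-] <-]; exists x => //=; rewrite h mulmxA.
by move=> _ [x xB <-]; exists (A *m x); [exists x | rewrite h mulmxA].
Qed.

Lemma ellipsoid_orthogonal A U : U^T *m U = 1%:M -> ellipsoid (A *m U) = ellipsoid A.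
Proof.
move=> UU; apply/seteqP; split=> _ [x xB <-].
  by exists (U *m x); rewrite ?mulmxA // /cball /= enorm_orthogonal.
exists (U^T *m x); last by rewrite mulmxA -(mulmxA A) (mulmx1C UU) mulmx1.
by rewrite /cball /= enorm_orthogonal // trmxK (mulmx1C UU).
Qed.

Lemma xcZ (a : R) (z : R2n R n) j : xc (a *: z) j = a * xc z j.
Proof. by rewrite /xc mxE. Qed.

Lemma ycZ (a : R) (z : R2n R n) j : yc (a *: z) j = a * yc z j.
Proof. by rewrite /yc mxE. Qed.

Lemma xc_polydiag r z j : xc (polydiag r *m z) j = r j * xc z j.
Proof.
rewrite /xc -{1}[z]vsubmxK mul_block_col !mul0mx addr0 add0r col_mxEu.
by rewrite mul_diag_mx !mxE.
Qed.

Lemma yc_polydiag r z j : yc (polydiag r *m z) j = r j * yc z j.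
Proof.
rewrite /yc -{1}[z]vsubmxK mul_block_col !mul0mx addr0 add0r col_mxEd.
by rewrite mul_diag_mx !mxE.
Qed.

Lemma polydiagK r : (forall j, 0 < r j) ->
  polydiag r *m polydiag (fun j => (r j)^-1) = 1%:M.
Proof.
move=> r0; rewrite mulmx_block !(mul0mx, mulmx0, addr0, add0r) scalar_mx_block.
by rewrite mulmx_diag -diag_const_mx; congr block_mx; congr diag_mx;
  apply/matrixP => i j; rewrite !mxE mulfV // gt_eqF.
Qed.

Lemma tr_polydiag r : (polydiag r)^T = polydiag r.
Proof. by rewrite tr_block_mx !trmx0 !tr_diag_mx. Qed.

Lemma dot_xyc (u v : R2n R n) :
  dot u v = \sum_j (xc u j * xc v j + yc u j * yc v j).
Proof. by rewrite dotE big_split_ord /= -big_split. Qed.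

Lemma std_ellipsoidE r : (forall j, 0 < r j) ->
  std_ellipsoid r = ellipsoid (polydiag r).
Proof.
move=> r0; have norm_inv z : (\sum_(j < n) (xc z j ^+ 2 + yc z j ^+ 2) / r j ^+ 2 <= 1)
    = (enorm (polydiag (fun j => (r j)^-1) *m z) <= 1).
  rewrite enorm_le // expr1n dot_xyc; congr (_ <= _); apply: eq_bigr => j _.
  by rewrite xc_polydiag yc_polydiag -exprVn; ring.
apply/seteqP; split=> [z zr|_ [z zB <-]].
  exists (polydiag (fun j => (r j)^-1) *m z); first by rewrite /cball /= -norm_inv.
  by rewrite mulmxA polydiagK // mul1mx.
apply: etrans (norm_inv _) _.
by rewrite mulmxA (mulmx1C (polydiagK r0)) mul1mx.
Qed.

(** xi |-> |A^T xi| is the support function of E(A), hence monotone in E(A). *)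
Lemma ellipsoid_support A B xi :
  ellipsoid A `<=` ellipsoid B -> enorm (A^T *m xi) <= enorm (B^T *m xi).
Proof.
move=> AB; set x := A^T *m xi.
have [->|x0] := eqVneq x 0; first by rewrite enorm0 enorm_ge0.
have nx : 0 < enorm x by rewrite enorm_gt0.
have [|y yB yE] := AB (A *m ((enorm x)^-1 *: x)).
  exists ((enorm x)^-1 *: x) => //.
  by rewrite /cball /= enorm_le // dot_normalize // expr1n.
have : dot xi (A *m ((enorm x)^-1 *: x)) = enorm x.
  by rewrite dot_mul -/x dotZr -enorm_sqr expr2 mulrA mulVf ?mul1r // gt_eqF.
rewrite -yE dot_mul => <-; apply: le_trans (dot_le _ _) _.
by rewrite ler_piMr ?enorm_ge0.
Qed.

(** Depending only on the set E(A), this condition pins down the linear symplectic width w of E(A):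
    it holds exactly for lambda >= w^-2. *)
Definition width_bound A (lambda : R) :=
  forall xi eta, omega0 xi eta <= lambda * (enorm (A^T *m xi) * enorm (A^T *m eta)).

Lemma width_bound_eq A B lambda :
  ellipsoid A = ellipsoid B -> width_bound A lambda -> width_bound B lambda.
Proof.
move=> AB h xi eta; have e z : enorm (B^T *m z) = enorm (A^T *m z).
  by apply/le_anti; rewrite !ellipsoid_support ?AB.
by rewrite !e.
Qed.

(** The transpose of a symplectic matrix is symplectic: it preserves omega0 as a
    form on covectors. *)
Lemma width_bound_symplectic M A lambda : symplectic_mx M ->
  width_bound (M *m A) lambda <-> width_bound A lambda.
Proof.
move=> /symplectic_mx_tr sM; have [uM _] := symplectic_mx_inv sM.
split=> h xi eta.
  have := h (invmx M^T *m xi) (invmx M^T *m eta).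
  rewrite trmx_mul -!(mulmxA A^T) !(mulKVmx uM).
  by rewrite -(omega0_symplectic _ _ sM) !(mulKVmx uM).
by rewrite -(omega0_symplectic _ _ sM) trmx_mul -!(mulmxA A^T).
Qed.

Lemma omega0_xy (i j : 'I_n) :
  omega0 (delta_mx (lshift n i) 0) (delta_mx (rshift n j) 0) = (i == j)%:R :> R.
Proof. by rewrite omega0E dot_delta -colE mxE block_mxEur mxE. Qed.

Lemma omega0_xx (i j : 'I_n) :
  omega0 (delta_mx (lshift n i) 0) (delta_mx (lshift n j) 0) = 0 :> R.
Proof. by rewrite omega0E dot_delta -colE mxE block_mxEul mxE. Qed.

Lemma omega0_yy (i j : 'I_n) :
  omega0 (delta_mx (rshift n i) 0) (delta_mx (rshift n j) 0) = 0 :> R.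
Proof. by rewrite omega0E dot_delta -colE mxE block_mxEdr mxE. Qed.

Lemma enorm_polydiag_ge r z (a : R) : 0 <= a -> (forall j, a <= r j) ->
  a * enorm z <= enorm (polydiag r *m z).
Proof.
move=> a0 ar; rewrite -[X in X * _]ger0_norm // -enormZ enorm_leP !dot_xyc.
apply: ler_sum => j _; rewrite xc_polydiag yc_polydiag.
have ar2 : a ^+ 2 <= r j ^+ 2 by rewrite lerXn2r ?nnegrE // (le_trans a0).
rewrite xcZ ycZ.
have := ler_wpM2r (sqr_ge0 (xc z j)) ar2.
have := ler_wpM2r (sqr_ge0 (yc z j)) ar2; lra.
Qed.

(** The covectors of the plane of the smallest radius realise the bound. *)
Lemma width_bound_polydiag r (j0 : 'I_n) lambda :
  (forall j, 0 < r j) -> (forall j, r j0 <= r j) ->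
  width_bound (polydiag r) lambda <-> (r j0 ^+ 2)^-1 <= lambda.
Proof.
move=> r0 rj0; split=> [h|h xi eta].
  have := h (delta_mx (lshift n j0) 0) (delta_mx (rshift n j0) 0).
  rewrite omega0_xy eqxx tr_polydiag.
  have e i : (i == lshift n j0) || (i == rshift n j0) ->
      polydiag r *m delta_mx i 0 = r j0 *: delta_mx i 0 :> R2n R n.
    move=> hi; apply/matrixP => k l; rewrite ord1 -(splitK k).
    case: (fintype.split k) => a /=.
      rewrite -[LHS]/(xc _ _) xc_polydiag /xc !mxE eqxx andbT.
      case/orP: hi => /eqP ->; rewrite ?eq_lshift ?eq_lrshift ?mulr0 //.
      by case: eqVneq => [->|]; rewrite ?mulr0.
    rewrite -[LHS]/(yc _ _) yc_polydiag /yc !mxE eqxx andbT.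
    case/orP: hi => /eqP ->; rewrite ?eq_rshift ?eq_rlshift ?mulr0 //.
    by case: eqVneq => [->|]; rewrite ?mulr0.
  rewrite !e ?eqxx ?orbT // !enormZ !enormE !dot_delta_delta !eqxx sqrtr1 !mulr1.
  rewrite gtr0_norm // -expr2 => h1.
  by rewrite -div1r ler_pdivrMr // exprn_gt0.
rewrite tr_polydiag; apply: le_trans (ler_norm _) _.
apply: le_trans (omega0_le _ _) _.
have g z := enorm_polydiag_ge z (ltW (r0 j0)) rj0.
have : (r j0 * enorm xi) * (r j0 * enorm eta)
     <= enorm (polydiag r *m xi) * enorm (polydiag r *m eta).
  by apply: ler_pM => //; rewrite mulr_ge0 ?enorm_ge0 ?ltW.
have -> : r j0 * enorm xi * (r j0 * enorm eta) = r j0 ^+ 2 * (enorm xi * enorm eta).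
  by ring.
rewrite -ler_pdivlMl ?exprn_gt0 // => /le_trans; apply.
by rewrite ler_wpM2r // mulr_ge0 ?enorm_ge0.
Qed.

End Ellipsoids.

Section Width.
Variables (R : realType) (n : nat).
Hypothesis n_gt0 : (0 < n)%N.
Implicit Types (A B M : 'M[R]_(n + n)).

Lemma linear_symplectic_mx (Psi : {linear R2n R n -> R2n R n}) M :
  (forall u, Psi u = M *m u) -> linear_symplectic Psi -> symplectic_mx M.
Proof. by move=> h sP; apply: symplectic_mxP => u v; rewrite -!h. Qed.

(** A degenerate ellipsoid is contained in a hyperplane: its support function
    has a nontrivial zero. *)
Lemma ellipsoid_unit_inj A B :
  ellipsoid A = ellipsoid B -> A \in unitmx -> B \in unitmx.
Proof.
move=> AB uA; apply/negPn/negP; rewrite -unitmx_tr => /kernel_singular[x x0 Bx].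
have : enorm (A^T *m x) <= enorm (B^T *m x) by apply: ellipsoid_support; rewrite AB.
rewrite Bx enorm0 le_eqVlt ltNge enorm_ge0 orbF enorm_eq0 => /eqP Ax.
have uA' : A^T \in unitmx by rewrite unitmx_tr.
by move: x0; rewrite -[x](mulKmx uA') Ax mulmx0 eqxx.
Qed.

Lemma is_lin_width_bound A w : A \in unitmx -> is_lin_width (ellipsoid A) w ->
  0 < w /\ forall lambda, width_bound A lambda <-> (w ^+ 2)^-1 <= lambda.
Proof.
move=> uA [[B [uB AB [Psi [r [sP r0 rs PE [j0 j00 ->]]]]]]|[B [nB AB _]]]; last first.
  by move: nB; rewrite (ellipsoid_unit_inj AB).
split=> // lambda; have [M hM] := linear_cV_mx Psi.
have sM := linear_symplectic_mx hM sP.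
move: PE; rewrite (image_ellipsoid _ hM) std_ellipsoidE // => PE.
rewrite -(width_bound_polydiag (j0 := j0)) //; last first.
  by move=> j; apply: rs; rewrite j00.
by rewrite -(width_bound_symplectic _ _ sM); split; exact: width_bound_eq.
Qed.

(** Williamson's theorem guarantees that the choice made by [lin_width] is not the
    default value; it also provides the ball and the cylinder that the
    computation of capacities uses. *)
Lemma lin_width_ellipsoid A : A \in unitmx ->
  exists (Psi : 'M[R]_(n + n)) (r : 'I_n -> R),
   [/\ symplectic_mx Psi, forall j, 0 < r j,
       forall j, lin_width (ellipsoid A) <= r j,
       forall j : 'I_n, val j = 0%N -> lin_width (ellipsoid A) = r j &
       ellipsoid (Psi *m A) = ellipsoid (polydiag r)] /\
   is_lin_width (ellipsoid A) (lin_width (ellipsoid A)).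
Proof.
move=> uA; have [Psi [r [U [sP r0 rs UU PE]]]] := williamson uA.
have PEA : ellipsoid (Psi *m A) = ellipsoid (polydiag r).
  by rewrite PE ellipsoid_orthogonal //; move/mulmx1C: UU; rewrite trmxK.
exists Psi, r.
pose j0 := Ordinal n_gt0.
have w1 : is_lin_width (ellipsoid A) (r j0).
  left; exists A; split=> //.
  exists (mulmx Psi : {linear R2n R n -> R2n R n}), r; split=> //.
  - by move=> u v; rewrite omega0_symplectic.
  - by rewrite (@image_ellipsoid _ _ _ Psi) // std_ellipsoidE.
  - by exists j0.
have w2 : is_lin_width (ellipsoid A) (lin_width (ellipsoid A)).
  by apply: (xgetPex 0); exists (r j0).
have e : lin_width (ellipsoid A) = r j0.
  have [a0 ha] := is_lin_width_bound uA w1; have [b0 hb] := is_lin_width_bound uA w2.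
  have : (r j0 ^+ 2)^-1 = (lin_width (ellipsoid A) ^+ 2)^-1.
    by apply/le_anti/andP; split; [apply/ha/hb | apply/hb/ha].
  by move=> /invr_inj /eqP; rewrite eqrXn2 // ?ltW // => /eqP ->.
split=> //; split=> // j; first by rewrite e rs.
by move=> j00; rewrite e; congr (r _); apply: val_inj.
Qed.

Lemma lin_width_gt0 A : A \in unitmx -> 0 < lin_width (ellipsoid A).
Proof.
by move=> uA; have [Psi [r [_ /(is_lin_width_bound uA)[]]]] := lin_width_ellipsoid uA.
Qed.

Lemma lin_width_boundP A lambda : A \in unitmx ->
  width_bound A lambda <-> (lin_width (ellipsoid A) ^+ 2)^-1 <= lambda.
Proof.
by move=> uA; have [Psi [r [_ /(is_lin_width_bound uA)[_]]]] := lin_width_ellipsoid uA.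
Qed.

Lemma lin_width_singular A : A \notin unitmx -> lin_width (ellipsoid A) = 0.
Proof.
move=> nA; rewrite /lin_width; case: xgetP => // w _ [] [B [uB AB]].
  by move: nA; rewrite (ellipsoid_unit_inj (esym AB) uB).
by [].
Qed.

End Width.

(** * Linear maps that almost preserve widths *)

Section QuasiPreserving.
Variables (R : realType) (n : nat).
Hypothesis n_gt0 : (0 < n)%N.
Implicit Types (A C M N : 'M[R]_(n + n)) (x y : R2n R n).

(** Common ground of the linear and of the nonlinear hypotheses: the linear map
    M changes the width of E(A) at most by the factors 1 + d and 1 - d, where d
    is eta times an upper bound for the condition number of A. *)
Definition quasi_preserving (eta : R) M := forall A a b,
  A \in unitmx -> 0 <= a -> 0 <= b ->
  (forall z, enorm (A *m z) <= a * enorm z) ->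
  (forall z, enorm (invmx A *m z) <= b * enorm z) ->
  let d := b * eta * a in
  lin_width (ellipsoid A) <= (1 + d) * lin_width (ellipsoid (M *m A)) /\
  (d < 1 -> (1 - d) * lin_width (ellipsoid (M *m A)) <= lin_width (ellipsoid A)).

Lemma width_bound_inv A C lambda : C *m A = 1%:M ->
  width_bound A lambda <->
  forall x y, omega0 (C^T *m x) (C^T *m y) <= lambda * (enorm x * enorm y).
Proof.
move=> CA; have AC : A^T *m C^T = 1%:M by rewrite -trmx_mul CA trmx1.
split=> [h x y|h x y].
  by have := h (C^T *m x) (C^T *m y); rewrite !mulmxA AC !mul1mx.
by have := h (A^T *m x) (A^T *m y); rewrite !mulmxA (mulmx1C AC) !mul1mx.
Qed.

(** Its matrix is minus the inverse of the matrix of the pullback of omega0 under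
    M.  The widths of the ellipsoids E(M A) bound this form from above and from
    below, whereas they only see the smallest values of the pullback. *)
Definition dual_form M x y := omega0 ((invmx M)^T *m x) ((invmx M)^T *m y).

Section Bounds.
Variables (M : 'M[R]_(n + n)) (eta : R).
Hypotheses (uM : M \in unitmx) (qM : quasi_preserving eta M) (eta0 : 0 <= eta).
Variables (A C : 'M[R]_(n + n)) (a b lambda : R).
Hypotheses (CA : C *m A = 1%:M) (a0 : 0 <= a) (b0 : 0 <= b).
Hypotheses (hA : forall z, enorm (A *m z) <= a * enorm z).
Hypotheses (hC : forall z, enorm (C *m z) <= b * enorm z).

Let uA : A \in unitmx. Proof. by have [] := mulmx1_unit CA. Qed.
Let CE : C = invmx A. Proof. by rewrite -[C]mulmx1 -(mulmxV uA) mulmxA CA mul1mx. Qed.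
Let uMA : M *m A \in unitmx. Proof. by rewrite unitmx_mul uM. Qed.
Let CMA : (C *m invmx M) *m (M *m A) = 1%:M.
Proof. by rewrite mulmxA mulmxKV. Qed.

Let w := lin_width (ellipsoid A).
Let W := lin_width (ellipsoid (M *m A)).
Let w0 : 0 < w. Proof. exact: lin_width_gt0. Qed.
Let W0 : 0 < W. Proof. exact: lin_width_gt0. Qed.

Let dualE x y : omega0 ((C *m invmx M)^T *m x) ((C *m invmx M)^T *m y) =
  dual_form M (C^T *m x) (C^T *m y).
Proof. by rewrite /dual_form !mulmxA -trmx_mul. Qed.

Let hqM : w <= (1 + b * eta * a) * W /\ (b * eta * a < 1 -> (1 - b * eta * a) * W <= w).
Proof. by apply: qM => // z; rewrite -CE. Qed.

(** Upper bounds for the form read through C = A^-1 are the same thing as lower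
    bounds for the width of E(A); so the first width estimate transports upper
    bounds from omega0 to the dual form, and the second one transports them
    back. *)
Lemma dual_form_upper :
  (forall x y, omega0 (C^T *m x) (C^T *m y) <= lambda * (enorm x * enorm y)) ->
  forall x y, dual_form M (C^T *m x) (C^T *m y) <=
    (1 + b * eta * a) ^+ 2 * lambda * (enorm x * enorm y).
Proof.
move=> /(width_bound_inv _ CA).2 /(lin_width_boundP n_gt0 _ uA) h x y.
rewrite -dualE; move: x y; apply/(width_bound_inv _ CMA)/(lin_width_boundP n_gt0 _ uMA).
rewrite -/w -/W in h *; have [hw _] := hqM.
rewrite -div1r ler_pdivrMr ?exprn_gt0 // mulrAC -exprMn.
rewrite -div1r ler_pdivrMr ?exprn_gt0 // in h.
apply: (le_trans h); rewrite mulrC ler_wpM2r //.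
  by rewrite -(pmulr_lge0 _ (exprn_gt0 2 w0)) (le_trans ler01).
have h0 := le_trans (ltW w0) hw.
by rewrite lerXn2r ?nnegrE ?(ltW w0).
Qed.

Lemma dual_form_lower : b * eta * a < 1 ->
  (forall x y, dual_form M (C^T *m x) (C^T *m y) <= lambda * (enorm x * enorm y)) ->
  forall x y, (1 - b * eta * a) ^+ 2 * omega0 (C^T *m x) (C^T *m y) <=
    lambda * (enorm x * enorm y).
Proof.
move=> d1 h x y.
have /(lin_width_boundP n_gt0 _ uMA) : width_bound (M *m A) lambda.
  by apply/(width_bound_inv _ CMA) => u v; rewrite dualE.
rewrite -/W -div1r ler_pdivrMr ?exprn_gt0 // => hl.
have [_ /(_ d1) hw] := hqM; set d := b * eta * a in d1 hw *.
have d0 : 0 < (1 - d) ^+ 2 by rewrite exprn_gt0 // subr_gt0.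
rewrite -ler_pdivlMl // [leRHS]mulrA; move: x y.
apply/(width_bound_inv _ CA)/(lin_width_boundP n_gt0 _ uA).
rewrite -/w -div1r ler_pdivrMr ?exprn_gt0 // -mulrA ler_pdivlMl // mulr1.
have l0 : 0 <= lambda.
  by rewrite -(pmulr_lge0 _ (exprn_gt0 2 W0)) (le_trans ler01).
have := ler_wpM2l (ltW d0) hl; rewrite mulr1 => /le_trans; apply.
rewrite mulrCA ler_wpM2l // -exprMn lerXn2r ?nnegrE ?(ltW w0) //.
by rewrite mulr_ge0 ?(ltW W0) // subr_ge0 ltW.
Qed.

End Bounds.

(** For orthonormal c1 and c2 these are the orthogonal projection onto the plane
    of c1 and c2, and the map that fixes this plane and multiplies its orthogonal
    complement by s. *)
Definition plane_proj (c1 c2 : R2n R n) : 'M[R]_(n + n) := c1 *m c1^T + c2 *m c2^T.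
Definition squeeze (c1 c2 : R2n R n) (s : R) : 'M[R]_(n + n) :=
  s%:M + (1 - s) *: plane_proj c1 c2.

Section Squeeze.
Variables c1 c2 : R2n R n.
Hypotheses (n1 : dot c1 c1 = 1) (n2 : dot c2 c2 = 1) (o12 : dot c1 c2 = 0).

Let Pi := plane_proj c1 c2.

Lemma plane_projE x : Pi *m x = dot c1 x *: c1 + dot c2 x *: c2.
Proof.
rewrite mulmxDl -!mulmxA; congr (_ + _); apply/matrixP => i j;
by rewrite ord1 [LHS]mxE big_ord1 [RHS]mxE mulrC.
Qed.

Lemma plane_projK : Pi *m Pi = Pi.
Proof.
have e x : Pi *m (Pi *m x) = Pi *m x.
  rewrite !plane_projE !dotDr !dotZr n1 n2 (dotC c2 c1) o12.
  by rewrite !mulr0 !mulr1 addr0 add0r.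
apply/matrixP => i j.
by have := congr1 (fun v : R2n R n => v i 0) (e (delta_mx j 0)); rewrite mulmxA -!colE !mxE.
Qed.

Lemma tr_plane_proj : Pi^T = Pi.
Proof. by rewrite linearD /= !trmx_mul !trmxK. Qed.

Lemma tr_squeeze s : (squeeze c1 c2 s)^T = squeeze c1 c2 s.
Proof. by rewrite linearD /= tr_scalar_mx linearZ /= tr_plane_proj. Qed.

Lemma squeezeE s x : squeeze c1 c2 s *m x = s *: x + (1 - s) *: (Pi *m x).
Proof. by rewrite mulmxDl mul_scalar_mx -scalemxAl. Qed.

Lemma squeezeM s t : squeeze c1 c2 s *m squeeze c1 c2 t = squeeze c1 c2 (s * t).
Proof.
rewrite /squeeze mulmxDl !mulmxDr -!scalar_mxM !mul_scalar_mx -!scalemxAl.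
rewrite -!scalemxAr plane_projK -/Pi mul_mx_scalar !scalerA -!addrA; congr (_ + _).
by rewrite -!scalerDl; congr (_ *: _); ring.
Qed.

Lemma squeeze1 : squeeze c1 c2 1 = 1%:M.
Proof. by rewrite /squeeze subrr scale0r addr0. Qed.

Lemma plane_proj_sqr x : dot (Pi *m x) (Pi *m x) = dot c1 x ^+ 2 + dot c2 x ^+ 2.
Proof.
rewrite plane_projE !(dotDl, dotDr, dotZl, dotZr) n1 n2 (dotC c2 c1) o12; ring.
Qed.

Lemma dot_plane_proj x : dot x (Pi *m x) = dot (Pi *m x) (Pi *m x).
Proof. by rewrite [RHS]dot_mul mulmxA tr_plane_proj plane_projK dotC. Qed.

Lemma plane_proj_le x : enorm (Pi *m x) <= enorm x.
Proof.
rewrite enorm_leP; have := dot_ge0 (x - Pi *m x).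
by rewrite !(dotBl, dotBr) (dotC _ x) dot_plane_proj; lra.
Qed.

Lemma squeeze_sqr s x : dot (squeeze c1 c2 s *m x) (squeeze c1 c2 s *m x) =
  s ^+ 2 * dot x x + (1 - s ^+ 2) * dot (Pi *m x) (Pi *m x).
Proof.
by rewrite squeezeE !(dotDl, dotDr, dotZl, dotZr) (dotC _ x) dot_plane_proj; ring.
Qed.

Lemma squeeze_le1 s x : 0 <= s <= 1 -> enorm (squeeze c1 c2 s *m x) <= enorm x.
Proof.
move=> /andP[s0 s1]; rewrite enorm_leP squeeze_sqr.
have := plane_proj_le x; rewrite enorm_leP => h.
have s2 : 0 <= 1 - s ^+ 2 by rewrite subr_ge0 expr_le1.
by have := ler_wpM2l s2 h; lra.
Qed.

Lemma squeeze_ge1 s x : 1 <= s -> enorm (squeeze c1 c2 s *m x) <= s * enorm x.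
Proof.
move=> s1; have s0 : 0 <= s by lra.
rewrite -[X in X * _]ger0_norm // -enormZ enorm_leP squeeze_sqr dotZl dotZr.
have s2 : 0 <= s ^+ 2 - 1 by rewrite subr_ge0 expr_ge1.
by have := mulr_ge0 s2 (dot_ge0 (Pi *m x)); lra.
Qed.

(** After squeezing, only the value on (c1, c2) of a two-form survives up to
    O(delta). *)
Lemma squeeze_form N k delta x y :
  (forall x y, `|omega0 (N *m x) (N *m y)| <= k * (enorm x * enorm y)) ->
  0 <= k -> 0 <= delta <= 1 ->
  `|omega0 (N *m (squeeze c1 c2 delta *m x)) (N *m (squeeze c1 c2 delta *m y))| <=
  (`|omega0 (N *m c1) (N *m c2)| + 2 * delta * k) * (enorm x * enorm y).
Proof.
move=> hN k0 /[dup] d01 /andP[d0 d1].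
pose f x y := omega0 (N *m x) (N *m y).
have fD1 u v z : f (u + v) z = f u z + f v z by rewrite /f mulmxDr !omega0E dotDl.
have fD2 u v z : f z (u + v) = f z u + f z v by rewrite /f mulmxDr !omega0E mulmxDr dotDr.
have fZ1 c u z : f (c *: u) z = c * f u z by rewrite /f -scalemxAr !omega0E dotZl.
have fZ2 c u z : f z (c *: u) = c * f z u.
  by rewrite /f -scalemxAr !omega0E -scalemxAr dotZr.
have fC u v : f u v = - f v u by rewrite /f omega0C.
have f0 u : f u u = 0 by have := fC u u; lra.
set D := dot c1 x * dot c2 y - dot c2 x * dot c1 y.
have fPi : f (Pi *m x) (Pi *m y) = f c1 c2 * D.
  rewrite !plane_projE !(fD1, fD2, fZ1, fZ2) !f0 (fC c2 c1) /D; ring.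
have hD : `|D| <= enorm x * enorm y.
  have : `|D| <= enorm (Pi *m x) * enorm (Pi *m y).
    rewrite -ler_sqr ?nnegrE ?mulr_ge0 ?enorm_ge0 // real_normK ?num_real //.
    rewrite exprMn !enorm_sqr !plane_proj_sqr -subr_ge0.
    have -> : (dot c1 x ^+ 2 + dot c2 x ^+ 2) * (dot c1 y ^+ 2 + dot c2 y ^+ 2) - D ^+ 2
       = (dot c1 x * dot c1 y + dot c2 x * dot c2 y) ^+ 2 by rewrite /D; ring.
    exact: sqr_ge0.
  by move=> /le_trans; apply; apply: ler_pM; rewrite ?enorm_ge0 ?plane_proj_le.
set Cx := squeeze c1 c2 delta *m x; set Cy := squeeze c1 c2 delta *m y.
have h1 : `|f x Cy| <= k * (enorm x * enorm y).
  apply: le_trans (hN _ _) _; rewrite ler_wpM2l // ler_wpM2l ?enorm_ge0 //.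
  exact: squeeze_le1.
have h2 : `|f (Pi *m x) y| <= k * (enorm x * enorm y).
  apply: le_trans (hN _ _) _; rewrite ler_wpM2l // ler_wpM2r ?enorm_ge0 //.
  exact: plane_proj_le.
have h3 : `|f c1 c2 * D| <= `|f c1 c2| * (enorm x * enorm y).
  by rewrite normrM ler_wpM2l.
have -> : omega0 (N *m Cx) (N *m Cy) =
    delta * f x Cy + (1 - delta) * (delta * f (Pi *m x) y + (1 - delta) * (f c1 c2 * D)).
  rewrite -fPi -/(f Cx Cy) [Cx]squeezeE fD1 !fZ1; congr (_ + _ * _).
  by rewrite [Cy]squeezeE fD2 !fZ2.
set E := enorm x * enorm y in h1 h2 h3 *.
have E0 : 0 <= E by rewrite mulr_ge0 ?enorm_ge0.
have dd : 0 <= 1 - delta by lra.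
apply: le_trans (ler_normD _ _) _; rewrite !normrM !(ger0_norm d0) (ger0_norm dd).
have h4 : (1 - delta) * `|delta * f (Pi *m x) y + (1 - delta) * (f c1 c2 * D)| <=
    delta * (k * E) + `|f c1 c2| * E.
  apply: le_trans (_ : 1 * `|delta * f (Pi *m x) y + (1 - delta) * (f c1 c2 * D)| <= _).
    by rewrite ler_wpM2r //; lra.
  rewrite mul1r; apply: le_trans (ler_normD _ _) _; rewrite !normrM (ger0_norm d0).
  rewrite (ger0_norm dd); apply: lerD; first by rewrite ler_wpM2l.
  rewrite -normrM; apply: le_trans h3.
  by rewrite -[leRHS]mul1r ler_wpM2r //; lra.
by have := ler_wpM2l d0 h1; rewrite /f in h4 *; lra.
Qed.

End Squeeze.

(** The ellipsoid E(A) with A^-1 = squeeze c1 c2 delta has distortion at most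
    eta / delta <= delta, and only the values at (c1, c2) survive in its width
    estimates.  Widths are blind to the sign of a form, whence the absolute
    values. *)
Lemma dual_form_orthonormal M eta delta c1 c2 :
  M \in unitmx -> quasi_preserving eta M -> 0 <= eta -> eta <= delta ^+ 2 ->
  0 < delta -> 10 * delta <= 1 -> dot c1 c1 = 1 -> dot c2 c2 = 1 -> dot c1 c2 = 0 ->
  `|omega0 c1 c2| - 5 * delta <= `|dual_form M c1 c2| <= `|omega0 c1 c2| + 5 * delta.
Proof.
move=> uM qM eta0 etad d0 d1 n1 n2 o12.
have d1' : 0 <= delta <= 1 by lra.
have symm (f : R2n R n -> R2n R n -> R) k : (forall x y, f x y = - f y x) ->
    (forall x y, f x y <= k * (enorm x * enorm y)) ->
    forall x y, `|f x y| <= k * (enorm x * enorm y).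
  move=> fC h x y; rewrite ler_norml h andbT lerNl -fC.
  by have := h y x; rewrite (mulrC (enorm y)).
have dC x y : dual_form M x y = - dual_form M y x by rewrite /dual_form omega0C.
(* With A = 1 the first estimate bounds the dual form on all vectors. *)
have hQ x y : `|dual_form M x y| <= (1 + delta) ^+ 2 * (enorm x * enorm y).
  apply: symm => // u v.
  have id1 z : enorm (1%:M *m z : R2n R n) <= 1 * enorm z by rewrite mul1mx mul1r.
  have := @dual_form_upper M eta uM qM 1%:M 1%:M 1 1 1 (mulmx1 _) ler01 ler01 id1 id1.
  rewrite !trmx1 mul1r !mulr1 => /(_ _ u v); rewrite !mul1mx => up.
  apply: le_trans (up _) _.
    by move=> a b; rewrite !mul1mx mul1r (le_trans (ler_norm _)) ?omega0_le.
  rewrite ler_wpM2r ?mulr_ge0 ?enorm_ge0 // lerXn2r ?nnegrE; nra.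
have hw x y : `|omega0 (1%:M *m x : R2n R n) (1%:M *m y)| <= 1 * (enorm x * enorm y).
  by rewrite !mul1mx mul1r omega0_le.
pose C := squeeze c1 c2 delta; pose A := squeeze c1 c2 delta^-1.
have CA : C *m A = 1%:M by rewrite squeezeM // mulfV ?gt_eqF // squeeze1.
have hA z : enorm (A *m z) <= delta^-1 * enorm z.
  by rewrite squeeze_ge1 // invf_ge1 //; lra.
have hC z : enorm (C *m z) <= 1 * enorm z by rewrite mul1r squeeze_le1.
have b0 : 0 <= delta^-1 by rewrite invr_ge0 ltW.
have C1 : C *m c1 = c1.
  rewrite squeezeE plane_projE n1 (dotC c2 c1) o12 scale0r addr0 !scale1r -scalerDl.
  by rewrite addrC subrK scale1r.
have C2 : C *m c2 = c2.
  rewrite squeezeE plane_projE n2 o12 scale0r add0r !scale1r -scalerDl.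
  by rewrite addrC subrK scale1r.
have e1 : enorm c1 = 1 by rewrite enormE n1 sqrtr1.
have e2 : enorm c2 = 1 by rewrite enormE n2 sqrtr1.
have CT : C^T = C by exact: tr_squeeze.
have dd : 1 * eta * delta^-1 <= delta by rewrite mul1r ler_pdivrMr // -expr2.
have dd0 : 0 <= 1 * eta * delta^-1 by rewrite mul1r mulr_ge0.
set d := 1 * eta * delta^-1 in dd dd0.
have t1 : `|omega0 c1 c2| <= 1 by have := omega0_le c1 c2; rewrite e1 e2 mulr1.
have t0 := normr_ge0 (omega0 c1 c2); have q0 := normr_ge0 (dual_form M c1 c2).
have dd2 : (1 + d) ^+ 2 <= (1 + delta) ^+ 2 by rewrite lerXn2r ?nnegrE; lra.
have dd3 : (1 - delta) ^+ 2 <= (1 - d) ^+ 2 by rewrite lerXn2r ?nnegrE; lra.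
apply/andP; split.
- have dlt : d < 1 by lra.
  have h x y : dual_form M (C^T *m x) (C^T *m y) <=
      (`|dual_form M c1 c2| + 2 * delta * (1 + delta) ^+ 2) * (enorm x * enorm y).
    rewrite CT; apply: le_trans (ler_norm _) _.
    by apply: (@squeeze_form _ _ n1 n2 o12 (invmx M)^T) => //; rewrite exprn_ge0 //; lra.
  have low := @dual_form_lower M eta uM qM A C delta^-1 1 _ CA b0 ler01 hA hC dlt h.
  have := low c1 c2; have := low c2 c1; rewrite CT C1 C2 e1 e2 !mulr1 (omega0C c2 c1).
  rewrite -/d => l1 l2.
  have : (1 - d) ^+ 2 * `|omega0 c1 c2| <=
      `|dual_form M c1 c2| + 2 * delta * (1 + delta) ^+ 2.
    by case: (ger0P (omega0 c1 c2)) => _; [exact: l2 | exact: l1].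
  have := ler_wpM2r t0 dd3; nra.
- have h x y : omega0 (C^T *m x) (C^T *m y) <=
      (`|omega0 c1 c2| + 2 * delta) * (enorm x * enorm y).
    rewrite CT; apply: le_trans (ler_norm _) _.
    by have := squeeze_form n1 n2 o12 x y hw ler01 d1'; rewrite !mul1mx mulr1.
  have up := @dual_form_upper M eta uM qM A C delta^-1 1 _ CA b0 ler01 hA hC h.
  have := up c1 c2; have := up c2 c1; rewrite CT C1 C2 e1 e2 !mulr1 (dC c2 c1).
  rewrite -/d => u1 u2.
  have : `|dual_form M c1 c2| <= (1 + d) ^+ 2 * (`|omega0 c1 c2| + 2 * delta).
    by case: (ger0P (dual_form M c1 c2)) => _; [exact: u2 | exact: u1].
  have t2 : 0 <= `|omega0 c1 c2| + 2 * delta by lra.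
  have := ler_wpM2r t2 dd2; nra.
Qed.

End QuasiPreserving.

Section Closeness.
Variables (R : realType) (n : nat).
Implicit Types (M : 'M[R]_(n + n)) (x y u v : R2n R n).

Let ex (i : 'I_n) : R2n R n := delta_mx (lshift n i) 0.
Let ey (i : 'I_n) : R2n R n := delta_mx (rshift n i) 0.

Lemma dot_exex i j : dot (ex i) (ex j) = (i == j)%:R.
Proof. by rewrite dot_delta_delta eq_lshift. Qed.
Lemma dot_eyey i j : dot (ey i) (ey j) = (i == j)%:R.
Proof. by rewrite dot_delta_delta eq_rshift. Qed.
Lemma dot_exey i j : dot (ex i) (ey j) = 0.
Proof. by rewrite dot_delta_delta eq_lrshift. Qed.

Lemma bilinear_le m (E : 'M[R]_m) a : 0 <= a ->
  (forall i j, `|E i j| <= a) ->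
  forall x y : 'cV[R]_m, `|dot x (E *m y)| <= a * m%:R ^+ 2 * (enorm x * enorm y).
Proof.
move=> a0 hE x y.
have sum_le (z : 'cV[R]_m) : \sum_i `|z i 0| <= m%:R * enorm z.
  rewrite -[X in X%:R]card_ord -sum1_card natr_sum mulr_suml.
  by apply: ler_sum => i _; rewrite mul1r enorm_coord.
have hEy i : `|(E *m y) i 0| <= a * (m%:R * enorm y).
  rewrite mxE; apply: le_trans (ler_norm_sum _ _ _) _.
  apply: le_trans (_ : a * \sum_j `|y j 0| <= _); last by rewrite ler_wpM2l.
  by rewrite mulr_sumr; apply: ler_sum => j _; rewrite normrM ler_wpM2r.
rewrite dotE; apply: le_trans (ler_norm_sum _ _ _) _.
apply: le_trans (_ : (\sum_i `|x i 0|) * (a * (m%:R * enorm y)) <= _).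
  by rewrite mulr_suml; apply: ler_sum => j _; rewrite normrM ler_wpM2l.
apply: le_trans (_ : m%:R * enorm x * (a * (m%:R * enorm y)) <= _).
  by rewrite ler_wpM2r ?mulr_ge0 ?enorm_ge0.
by rewrite le_eqVlt; apply/orP; left; apply/eqP; ring.
Qed.

Section Signs.
Variables (M : 'M[R]_(n + n)) (eta delta : R).
Hypothesis n_gt0 : (0 < n)%N.
Hypotheses (uM : M \in unitmx) (qM : quasi_preserving eta M).
Hypotheses (eta0 : 0 <= eta) (etad : eta <= delta ^+ 2).
Hypotheses (d0 : 0 < delta) (d1 : 20 * delta <= 1).

Let Q := dual_form M.

Let d01 : 10 * delta <= 1. Proof. by move: d0 d1; lra. Qed.

Let QC x y : Q x y = - Q y x. Proof. by rewrite /Q /dual_form omega0C. Qed.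
Let QDl u v z : Q (u + v) z = Q u z + Q v z.
Proof. by rewrite /Q /dual_form mulmxDr !omega0E dotDl. Qed.
Let QDr u v z : Q z (u + v) = Q z u + Q z v.
Proof. by rewrite QC QDl !(QC _ z) opprD !opprK. Qed.
Let QZl c u z : Q (c *: u) z = c * Q u z.
Proof. by rewrite /Q /dual_form -scalemxAr !omega0E dotZl. Qed.
Let QZr c u z : Q z (c *: u) = c * Q z u.
Proof. by rewrite QC QZl !(QC _ z) mulrN opprK. Qed.

Let test x y : dot x x = 1 -> dot y y = 1 -> dot x y = 0 ->
  `|omega0 x y| - 5 * delta <= `|Q x y| <= `|omega0 x y| + 5 * delta.
Proof. by move=> xx yy xy; apply: (@dual_form_orthonormal _ _ n_gt0 _ eta). Qed.

Let Qxx i j : `|Q (ex i) (ex j)| <= 5 * delta.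
Proof.
have [D0 D1] := (d0, d1).
have [->|ij] := eqVneq i j.
  have := QC (ex j) (ex j) => h; have -> : Q (ex j) (ex j) = 0 by lra.
  by rewrite normr0; lra.
have := @test (ex i) (ex j); rewrite !dot_exex !eqxx (negPf ij) omega0_xx normr0.
by move=> /(_ erefl erefl erefl) /andP[_]; rewrite add0r.
Qed.

Let Qyy i j : `|Q (ey i) (ey j)| <= 5 * delta.
Proof.
have [D0 D1] := (d0, d1).
have [->|ij] := eqVneq i j.
  have := QC (ey j) (ey j) => h; have -> : Q (ey j) (ey j) = 0 by lra.
  by rewrite normr0; lra.
have := @test (ey i) (ey j); rewrite !dot_eyey !eqxx (negPf ij) omega0_yy normr0.
by move=> /(_ erefl erefl erefl) /andP[_]; rewrite add0r.
Qed.

Let Qxy i j : i != j -> `|Q (ex i) (ey j)| <= 5 * delta.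
Proof.
move=> ij; have := @test (ex i) (ey j).
rewrite dot_exex dot_eyey dot_exey !eqxx omega0_xy (negPf ij) normr0.
by move=> /(_ erefl erefl erefl) /andP[_]; rewrite add0r.
Qed.

Let Qii i : 1 - 5 * delta <= `|Q (ex i) (ey i)| <= 1 + 5 * delta.
Proof.
have := @test (ex i) (ey i).
by rewrite dot_exex dot_eyey dot_exey !eqxx omega0_xy eqxx normr1; apply.
Qed.

(** The normalised pair (e_i + e_k, f_i + f_k) has omega0 equal to 1; if the
    values at (e_i, f_i) and (e_k, f_k) had opposite signs, the dual form would
    nearly vanish on this pair. *)
Let same_sign i k : 0 < Q (ex i) (ey i) -> 0 < Q (ex k) (ey k).
Proof.
have [D0 D1] := (d0, d1).
have [->//|ik] := eqVneq i k; move=> Qi; rewrite ltNge; apply/negP => Qk.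
pose s : R := (Num.sqrt 2)^-1.
have s2 : s * s = 2^-1 by rewrite -expr2 exprVn sqr_sqrtr.
have := @test (s *: (ex i + ex k)) (s *: (ey i + ey k)).
rewrite omega0E -scalemxAr mulmxDr !(dotZl, dotZr, dotDl, dotDr) -!omega0E.
rewrite !(QZl, QZr, QDl, QDr) !(dot_exex, dot_eyey, dot_exey, omega0_xy).
rewrite (eq_sym k i) (negPf ik) !eqxx !mulrA s2 !(addr0, add0r).
have hf : (2 : R)^-1 * (1 + 1) = 1 by rewrite -[1 + 1]/(2%:R) mulVf.
have -> : s * (s * 1 + s * 1) = 1.
  by rewrite (_ : _ * _ = s * s * (1 + 1)); [rewrite s2 | ring].
rewrite hf mulr0 normr1 => /(_ erefl erefl erefl) /andP[h1 _].
have := Qii i; have := Qii k; have := Qxy ik; have := @Qxy k i.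
rewrite eq_sym ik => /(_ isT).
rewrite (gtr0_norm Qi) (ler0_norm Qk) !ler_norml => b1 b2 b3 b4.
by move: h1; case: (ger0P (_ * _)) => _; lra.
Qed.

Lemma dual_form_sign : exists sg : R, (sg = 1 \/ sg = -1) /\
  forall i j, `|Q (delta_mx i 0) (delta_mx j 0)
      - sg * omega0 (delta_mx i 0) (delta_mx j 0)| <= 5 * delta.
Proof.
have [D0 D1] := (d0, d1).
pose i0 := Ordinal n_gt0.
pose sg : R := if 0 < Q (ex i0) (ey i0) then 1 else -1.
have hii i : `|Q (ex i) (ey i) - sg| <= 5 * delta.
  have := Qii i; rewrite /sg; case: ifP => [p0|p0].
    by rewrite (gtr0_norm (same_sign i p0)) ler_norml; lra.
  have : Q (ex i) (ey i) <= 0.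
    by rewrite leNgt; apply/negP => /(same_sign i0); rewrite p0.
  by move=> qi; rewrite (ler0_norm qi) ler_norml; lra.
have hxy i j : `|Q (ex i) (ey j) - sg * omega0 (ex i) (ey j)| <= 5 * delta.
  rewrite omega0_xy; case: eqVneq => [->|ij]; first by rewrite mulr1.
  by rewrite mulr0 subr0 Qxy.
exists sg; split; first by rewrite /sg; case: ifP; [left|right].
move=> i j; rewrite -(splitK i) -(splitK j).
case: (fintype.split i) => a; case: (fintype.split j) => b /=.
- by rewrite omega0_xx mulr0 subr0 Qxx.
- exact: hxy.
- by rewrite QC omega0C mulrN opprK addrC -normrN opprD opprK addrC hxy.
- by rewrite omega0_yy mulr0 subr0 Qyy.
Qed.

End Signs.

(** A bound on the difference of the dual forms transfers to the forms: with
    P = M^T J M, the dual form pairs P u and J v to omega0 u v. *)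
Lemma form_of_dual_form M sg k : M \in unitmx -> (sg = 1 \/ sg = -1) -> 0 <= k <= 2^-1 ->
  (forall x y, `|dual_form M x y - sg * omega0 x y| <= k * (enorm x * enorm y)) ->
  forall u v, `|omega0 (M *m u) (M *m v) - sg * omega0 u v|
    <= 2 * k * (enorm u * enorm v).
Proof.
move=> uM sg1 /andP[k0 k1] h u v; pose P := M^T *m Jmx *m M.
have key v' : `|omega0 u v' - sg * omega0 (M *m u) (M *m v')|
    <= k * (enorm (P *m u) * enorm v').
  have := h (P *m u) (Jmx *m v'); rewrite enorm_Jmx; congr (`|_ - _ * _| <= _).
    rewrite /dual_form /P -!mulmxA (mulmxA _ M^T) -trmx_mul mulmxV // trmx1 mul1mx.
    by rewrite omega0_Jl dot_mull mulmxA -trmx_mul mulVmx // trmx1 mul1mx omega0E.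
  rewrite omega0E mulmxA Jmx_sqr mulNmx mul1mx dotNr /P -!mulmxA dot_mull trmxK.
  by rewrite dotC -omega0E -omega0C.
have hP : enorm (P *m u) <= 2 * enorm u.
  have [->|p0] := eqVneq (P *m u) 0; first by rewrite enorm0 mulr_ge0 ?enorm_ge0.
  have pp : 0 < enorm (P *m u) by rewrite enorm_gt0.
  have := key (P *m u).
  have -> : omega0 (M *m u) (M *m (P *m u)) = - enorm (P *m u) ^+ 2.
    by rewrite omega0C enorm_sqr omega0E dot_mull; congr (- dot _ _); rewrite !mulmxA.
  have := omega0_le u (P *m u).
  rewrite !ler_norml; set p := enorm (P *m u) in pp *; set w := omega0 u _.
  move=> b1 b2; have {b1 b2} : p * (p - k * p) <= p * enorm u.
    by move: b1 b2; case: sg1 => ->; nra.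
  rewrite ler_pM2l // => b; have := ler_wpM2r (ltW pp) k1; lra.
have := key v; move: (omega0 u v) (omega0 (M *m u) _) => a a' hab.
have -> : `|a' - sg * a| = `|a - sg * a'|.
  by case: sg1 => ->; rewrite ?mul1r ?mulN1r ?opprK ?(distrC a) // addrC.
apply: le_trans hab _.
have := ler_wpM2r (enorm_ge0 v) hP => hv; have := ler_wpM2l k0 hv; lra.
Qed.

End Closeness.

(** * Norm estimates and the choice of the constant *)

Section FormNorm.
Variables (R : realType) (n : nat).
Implicit Types beta : R2n R n -> R2n R n -> R.

Lemma form_norm_le beta b : 0 <= b ->
  (forall i j, `|beta (delta_mx i 0) (delta_mx j 0)| <= b) ->
  form_norm beta <= (n + n)%:R * b.
Proof.
move=> b0 h; rewrite -[leRHS]ger0_norm ?mulr_ge0 // -sqrtr_sqr ler_wsqrtr //.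
apply: le_trans (_ : \sum_(i < n + n) \sum_(j < n + n) b ^+ 2 <= _).
  apply: ler_sum => i _; rewrite [leRHS](bigID (fun j : 'I_(n + n) => (i < j)%N)) /=.
  rewrite -[leLHS]addr0; apply: lerD; last by rewrite sumr_ge0 // => *; rewrite sqr_ge0.
  apply: ler_sum => j _; rewrite -[leLHS]real_normK ?num_real //.
  by rewrite lerXn2r ?nnegrE.
by rewrite !sumr_const card_ord -mulrnA -[leLHS]mulr_natl natrM exprMn expr2.
Qed.

Lemma form_norm_ge beta (i j : 'I_(n + n)) : (i < j)%N ->
  `|beta (delta_mx i 0) (delta_mx j 0)| <= form_norm beta.
Proof.
move=> ij; rewrite -sqrtr_sqr ler_wsqrtr // (bigD1 i) //= (bigD1 j) //= -addrA.
by rewrite lerDl addr_ge0 // sumr_ge0 // => *; rewrite ?sumr_ge0 // => *; rewrite sqr_ge0.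
Qed.

End FormNorm.

Section Closeness.
Variables (R : realType) (n : nat).
Hypothesis n_gt0 : (0 < n)%N.
Implicit Types (M : 'M[R]_(n + n)).

Definition close_cst : R := 80 * n%:R ^+ 3.

Lemma close_cst_ge80 : 80 <= close_cst.
Proof. by rewrite ler_peMr // exprn_ege1 // ler1n. Qed.

(** The factor 80 n^3 collects 5 delta for an entry of the dual form, (2n)^2 from
    entries to vectors, 2 from the inversion, and 2n from entries to the norm of
    a form. *)
Lemma quasi_preserving_close M eta delta :
  M \in unitmx -> quasi_preserving eta M -> 0 <= eta -> eta <= delta ^+ 2 ->
  0 < delta -> close_cst * delta <= 1 ->
  exists sg : R, (sg = 1 \/ sg = -1) /\
    form_norm (fun u v => omega0 (M *m u) (M *m v) - sg * omega0 u v)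
      <= close_cst * delta.
Proof.
move=> uM qM eta0 etad d0 d1.
have d20 : 20 * delta <= 1.
  by have := ler_wpM2r (ltW d0) close_cst_ge80; lra.
have [sg [sg1 hsg]] := dual_form_sign n_gt0 uM qM eta0 etad d0 d20.
exists sg; split=> //.
pose N := (invmx M)^T; pose E := N^T *m Jmx *m N - sg *: Jmx.
have EE x y : dual_form M x y - sg * omega0 x y = dot x (E *m y).
  by rewrite /dual_form !omega0E mulmxBl dotBr -scalemxAl dotZr dot_mull !mulmxA.
have hE i j : `|E i j| <= 5 * delta.
  by have := hsg i j; rewrite EE dot_delta -colE mxE.
pose k := 5 * delta * (n + n)%:R ^+ 2.
have nR : 1 <= n%:R :> R by rewrite ler1n.
have kE : 4 * n%:R * k = close_cst * delta by rewrite /k /close_cst natrD; ring.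
have k0 : 0 <= k by rewrite /k !mulr_ge0 // ?exprn_ge0 // ltW.
have k1 : k <= 2^-1.
  have : 4 * k <= 4 * n%:R * k by rewrite ler_wpM2r // ler_peMr.
  by rewrite kE => h; lra.
have d5 : 0 <= 5 * delta by lra.
have k01 : 0 <= k <= 2^-1 by rewrite k0.
have hk x y : `|dual_form M x y - sg * omega0 x y| <= k * (enorm x * enorm y).
  by rewrite EE; exact: bilinear_le.
have := form_of_dual_form uM sg1 k01 hk => h.
apply: le_trans (form_norm_le (b := 2 * k) _ _) _; first by rewrite mulr_ge0.
  move=> i j; apply: le_trans (h _ _) _.
  by rewrite !enormE !dot_delta_delta !eqxx sqrtr1 !mulr1.
by rewrite -kE natrD le_eqVlt; apply/orP; left; apply/eqP; ring.
Qed.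

Definition rho_excess (eps : R) : R := (rho eps)^-1 - 1.

(** The bound by eps is (1 + eps)^2 (1 - eps) >= 1. *)
Lemma rho_excess_bounds eps : 0 <= eps <= 2^-1 -> 0 <= rho_excess eps <= eps.
Proof.
move=> /andP[e0 e1].
have r0 : 0 < rho eps by rewrite sqrtr_gt0; lra.
have r2 : rho eps ^+ 2 = 1 - eps by rewrite sqr_sqrtr //; lra.
rewrite /rho_excess subr_ge0 lerBlDr -[(rho eps)^-1]div1r ler_pdivlMr //.
rewrite ler_pdivrMr // mul1r; apply/andP; split.
  by rewrite -[_ <= 1]ler_sqr ?nnegrE ?(ltW r0) // r2; lra.
have e2 : 0 <= (eps + 1) * rho eps by rewrite mulr_ge0 ?(ltW r0) //; lra.
by rewrite -ler_sqr ?nnegrE // exprMn r2; nra.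
Qed.

(** The natural choice delta = sqrt eps is 0 when eps is 0, where no squeezed
    ellipsoid is available.  So the estimate is used for delta slightly larger,
    and the alternative is settled by contradiction. *)
Lemma symplectic_or_anti M eps :
  0 <= eps -> close_cst * Num.sqrt eps < 1 -> M \in unitmx ->
  quasi_preserving (rho_excess eps) M ->
  form_norm (fun u v => omega0 (M *m u) (M *m v) - omega0 u v)
    <= close_cst * Num.sqrt eps \/
  form_norm (fun u v => omega0 (M *m u) (M *m v) + omega0 u v)
    <= close_cst * Num.sqrt eps.
Proof.
move=> e0 e1 uM qM; set a := form_norm _; set b := form_norm _.
have c80 := close_cst_ge80; set c := close_cst in c80 e1 *; set s := Num.sqrt eps in e1 *.
have s0 : 0 <= s by exact: sqrtr_ge0.
have s2 : s ^+ 2 = eps by rewrite sqr_sqrtr.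
have [ac|ca] := leP a (c * s); first by left.
have [bc|cb] := leP b (c * s); first by right.
pose t := Num.min 1 (Num.min a b).
have ct : c * s < t by rewrite !lt_min e1 ca cb.
(* A value of delta with s < delta and c delta < t. *)
pose delta := (c * s + t) / 2 / c.
have cn0 : c != 0 by rewrite gt_eqF //; lra.
have cd : c * delta = (c * s + t) / 2 by rewrite mulrCA mulfV // mulr1.
have sd : s < delta by rewrite -(ltr_pM2l (_ : 0 < c)) ?cd; lra.
have sm : s <= 2^-1 by nra.
have eb : 0 <= eps <= 2^-1 by rewrite -s2; nra.
have /andP[q0 qe] := rho_excess_bounds eb.
have t1 : t <= 1 by rewrite ge_min lexx.
have ta : t <= a by rewrite !ge_min lexx orbT.
have tb : t <= b by rewrite !ge_min lexx !orbT.
have [|||sg [sg1]] := @quasi_preserving_close M _ delta uM qM q0.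
- by apply: le_trans qe _; rewrite -s2; nra.
- by lra.
- by rewrite -/c cd; lra.
case: sg1 => ->.
  have -> : (fun u v => omega0 (M *m u) (M *m v) - 1 * omega0 u v) =
      (fun u v => omega0 (M *m u) (M *m v) - omega0 u v).
    by apply/funext => u; apply/funext => v; rewrite mul1r.
  by rewrite -/a -/c cd; lra.
have -> : (fun u v => omega0 (M *m u) (M *m v) - -1 * omega0 u v) =
    (fun u v => omega0 (M *m u) (M *m v) + omega0 u v).
  by apply/funext => u; apply/funext => v; rewrite mulN1r opprK.
by rewrite -/b -/c cd; lra.
Qed.

End Closeness.

(** * Linear maps with the two linear properties *)

Section Distortion.
Variables (R : realType) (n : nat).
Implicit Types (A M : 'M[R]_(n + n)).

Lemma opnorm_le A b : 0 <= b -> (forall z, enorm (A *m z) <= b * enorm z) ->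
  0 <= opnorm A <= b.
Proof.
move=> b0 h; pose S := [set enorm (A *m z) | z in [set z : R2n R n | enorm z <= 1]].
have S0 : S 0 by exists 0; rewrite /= ?mulmx0 enorm0.
have ubS : ubound S b.
  move=> _ [z /= z1 <-]; apply: le_trans (h z) _.
  by rewrite ler_piMr.
apply/andP; split; first by apply: ub_le_sup => //; exists b.
by apply: sup_le_ub => //; exists 0.
Qed.

Lemma rad_le A a : 0 <= a -> (forall z, enorm (A *m z) <= a * enorm z) ->
  0 <= Defs.rad A <= a.
Proof.
move=> a0 h; pose S := [set r : R | ellipsoid A `<=` cball n r].
have Sa : S a.
  move=> _ [z z1 <-]; apply: le_trans (h z) _.
  by rewrite ler_piMr.
have lbS : lbound S 0.
  move=> r; move=> /(_ 0) hr; rewrite -(enorm0 R (n + n)); apply: hr.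
  by exists 0; rewrite ?mulmx0 // /cball /= enorm0.
apply/andP; split; first by apply: lb_le_inf => //; exists a.
by apply: ge_inf => //; exists 0.
Qed.

(** The operator norm and the radius enter the argument only through these
    one-sided bounds. *)
Lemma distortion_le A eps a b : 0 <= rho_excess eps -> 0 <= a -> 0 <= b ->
  (forall z, enorm (A *m z) <= a * enorm z) ->
  (forall z, enorm (invmx A *m z) <= b * enorm z) ->
  0 <= distortion eps A <= b * rho_excess eps * a.
Proof.
move=> q0 a0 b0 hA hC; have /andP[p0 pb] := opnorm_le b0 hC.
have /andP[r0 ra] := rad_le a0 hA.
rewrite /distortion -/(rho_excess eps) !mulr_ge0 //=.
by apply: ler_pM; rewrite ?mulr_ge0 // ler_wpM2r.
Qed.

End Distortion.

Section LinearMaps.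
Variables (R : realType) (n : nat) (eps : R).
Hypothesis n_gt0 : (0 < n)%N.
Hypothesis q0 : 0 <= rho_excess eps.
Variables (Phi : {linear R2n R n -> R2n R n}) (M : 'M[R]_(n + n)).
Hypothesis PhiE : forall u, Phi u = M *m u.

(** Images of the unit ball under singular maps have width 0. *)
Lemma non_squeezing_unit : lin_non_squeezing eps Phi -> M \in unitmx.
Proof.
move=> /(_ 1%:M (unitmx1 _ _)); rewrite (image_ellipsoid _ PhiE) mulmx1 => h.
apply/negPn/negP => nM; move: h; rewrite (lin_width_singular nM) leNgt mulr_gt0 //.
  have id1 z : enorm (1%:M *m z : R2n R n) <= 1 * enorm z by rewrite mul1mx mul1r.
  have hC z : enorm (invmx 1%:M *m z : R2n R n) <= 1 * enorm z by rewrite invmx1.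
  have /andP[d0 _] := distortion_le q0 ler01 ler01 id1 hC.
  by rewrite invr_gt0; lra.
by apply: lin_width_gt0 => //; exact: unitmx1.
Qed.

Lemma non_squeezing_quasi : lin_non_squeezing eps Phi -> lin_non_expanding eps Phi ->
  quasi_preserving (rho_excess eps) M.
Proof.
move=> hs [_ he] A a b uA a0 b0 hA hC d.
have /andP[d0 dd] := distortion_le q0 a0 b0 hA hC.
rewrite -/d in dd; have uM := non_squeezing_unit hs.
have W0 : 0 < lin_width (ellipsoid (M *m A)) by apply: lin_width_gt0; rewrite ?unitmx_mul ?uM.
have w0 := lin_width_gt0 n_gt0 uA.
split=> [|d1].
  have := hs A uA; rewrite (image_ellipsoid _ PhiE) /s_ ler_pdivrMl; last by lra.
  by move=> /le_trans; apply; rewrite ler_wpM2r ?(ltW W0) //; lra.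
have := he A uA (le_lt_trans dd d1); rewrite (image_ellipsoid _ PhiE) /e_.
rewrite ler_pdivlMl; last by lra.
by apply: le_trans; rewrite ler_wpM2r ?(ltW W0) //; lra.
Qed.

End LinearMaps.

(** * Capacities of ellipsoids *)

Section EnormTopology.
Variables (R : realType) (m : nat).
Implicit Types (z : 'cV[R]_m) (M : 'M[R]_m).

Lemma nbhs_enormP z (P : set 'cV[R]_m) :
  nbhs z P <-> exists2 d : R, 0 < d & forall y, enorm (y - z) < d -> P y.
Proof.
split=> [/nbhs_normP[d /= d0 h]|[d d0 h]].
  exists d => // y yz; apply: h => /=; rewrite distrC.
  exact: le_lt_trans (norm_le_enorm _) yz.
apply: (nbhs_normP z P).2; exists (d / (m%:R + 1)) => [|y /=].
  by rewrite /= divr_gt0 // ltr_wpDl.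
rewrite distrC ltr_pdivlMr ?ltr_wpDl // => yz; apply: h.
apply: le_lt_trans (enorm_le_norm _) _; apply: le_lt_trans yz.
by rewrite mulrC ler_wpM2l // lerDl.
Qed.

Lemma continuous_enormP (f : 'cV[R]_m -> 'cV[R]_m) z :
  {for z, continuous f} <-> forall e, 0 < e ->
    exists2 d, 0 < d & forall y, enorm (y - z) < d -> enorm (f y - f z) < e.
Proof.
split=> [cf e e0|h].
  have : nbhs (f z) [set y | enorm (y - f z) < e] by apply/nbhs_enormP; exists e.
  by move=> /cf /nbhs_enormP.
move=> P /nbhs_enormP[e e0 hP]; have [d d0 hd] := h e e0.
by apply/nbhs_enormP; exists d => // y /hd; exact: hP.
Qed.

Lemma enorm_mulmx_le M : exists2 a : R, 0 <= a & forall z, enorm (M *m z) <= a * enorm z.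
Proof.
have hM i j : `|M i j| <= `|M| by exact: mx_norm_coord.
exists (`|M| * m%:R ^+ 2) => [|z]; first by rewrite mulr_ge0 ?exprn_ge0.
have [->|z0] := eqVneq (M *m z) 0; first by rewrite enorm0 !mulr_ge0 ?exprn_ge0 ?enorm_ge0.
have nz : 0 < enorm (M *m z) by rewrite enorm_gt0.
have := bilinear_le (normr_ge0 M) hM (M *m z) z.
by rewrite ger0_norm ?dot_ge0 // -enorm_sqr expr2 mulrCA ler_pM2l.
Qed.

Lemma continuous_mulmx M : continuous (mulmx M : 'cV[R]_m -> 'cV[R]_m).
Proof.
have [a a0 ha] := enorm_mulmx_le M.
move=> z; apply/continuous_enormP => e e0.
have a1 : 0 < a + 1 by lra.
exists (e / (a + 1)) => [|y]; first by rewrite divr_gt0.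
rewrite ltr_pdivlMr // -mulmxBr => h; apply: le_lt_trans (ha _) _.
by apply: le_lt_trans h; rewrite mulrC ler_wpM2l ?enorm_ge0 //; lra.
Qed.

End EnormTopology.

Section AffineSymplectic.
Variables (R : realType) (n : nat).
Implicit Types (p : R2n R n) (M A : 'M[R]_(n + n)) (U V : set (R2n R n)).

Lemma Ck_cst k U p : Ck k U (cst p).
Proof.
elim: k p => [|k IH] p /=; first by move=> z _; exact: cst_continuous.
split=> [z _|v]; first exact: differentiable_cst.
rewrite (_ : (fun z => _) = cst 0); first exact: IH.
by apply/funext => z; exact: derive_cst.
Qed.

Definition affine p M z : R2n R n := p + M *m z.

Lemma affineE p M : affine p M = cst p + (mulmx M : R2n R n -> R2n R n).
Proof. by []. Qed.

Lemma differentiable_affine p M z : differentiable (affine p M) z.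
Proof.
rewrite affineE; apply: differentiableD; first exact: differentiable_cst.
by apply: linear_differentiable; exact: continuous_mulmx.
Qed.

Lemma differentiable_mulmx M z : differentiable (mulmx M : R2n R n -> R2n R n) z.
Proof. by apply: linear_differentiable; exact: continuous_mulmx. Qed.

Lemma diff_affine p M z v : 'd (affine p M) z v = M *m v.
Proof.
have dD := congr1 (fun g => g v)
  (diffD (differentiable_cst p z) (differentiable_mulmx M z)).
have dp := congr1 (fun g => g v) (@diff_cst R (R2n R n) (R2n R n) p z).
have dM := congr1 (fun g => g v) (@diff_lin R (R2n R n) (R2n R n)
  (mulmx M : {linear R2n R n -> R2n R n}) z (@continuous_mulmx _ _ M)).
by apply: (etrans dD); apply: (etrans (congr2 +%R dp dM)); exact: add0r.
Qed.

Lemma smooth_affine k U p M : Ck k U (affine p M).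
Proof.
case: k => [|k] /=.
  by move=> z _; apply: differentiable_continuous; exact: differentiable_affine.
split=> [z _|v]; first exact: differentiable_affine.
rewrite (_ : (fun z => _) = cst (M *m v)); first exact: Ck_cst.
apply/funext => z; rewrite deriveE ?diff_affine //; exact: differentiable_affine.
Qed.

Lemma symplectic_embedding_affine p M :
  symplectic_mx M -> symplectic_embedding setT (affine p M).
Proof.
move=> sM; have [uM _] := symplectic_mx_inv sM; split; last first.
  by move=> z _ u v; rewrite /pullback !diff_affine omega0_symplectic.
split=> [k|z _ u v|].
- exact: smooth_affine.
- by rewrite !diff_affine => /(congr1 (mulmx (invmx M))); rewrite !mulKmx.
- exists (affine (- (invmx M *m p)) (invmx M)); split=> [z _|].
    by rewrite /affine mulmxDr mulKmx // addrA addNr add0r.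
  apply: continuous_subspaceT => z.
  by apply: differentiable_continuous; exact: differentiable_affine.
Qed.

Section Capacity.
Variable c : set (R2n R n) -> \bar R.
Hypothesis cap : capacity c.
Hypothesis n_gt0 : (0 < n)%N.

Lemma capacity_affine p M U V :
  symplectic_mx M -> (forall z, U z -> V (affine p M z)) -> (c U <= c V)%E.
Proof.
move=> sM UV; apply: (capacity_monotone cap openT (@subsetT _ U)
  (symplectic_embedding_affine p sM)).
by move=> _ [z Uz <-]; exact: UV.
Qed.

Lemma capacity_sub U V : U `<=` V -> (c U <= c V)%E.
Proof.
move=> UV; apply: (@capacity_affine 0 1%:M).
  by rewrite /symplectic_mx trmx1 mul1mx mulmx1.
by move=> z Uz; rewrite /affine add0r mul1mx; exact: UV.
Qed.

Lemma enorm_polydiag_le (r : 'I_n -> R) z : (forall j, 0 <= r j <= 1) ->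
  enorm (polydiag r *m z) <= enorm z.
Proof.
move=> r1; rewrite enorm_leP !dot_xyc; apply: ler_sum => j _.
rewrite xc_polydiag yc_polydiag; have /andP[r0j r1j] := r1 j.
have r2 : r j ^+ 2 <= 1 by rewrite expr_le1.
have := ler_wpM2r (sqr_ge0 (xc z j)) r2.
have := ler_wpM2r (sqr_ge0 (yc z j)) r2; lra.
Qed.

(** The normal form of E(A) lies between the ball and the cylinder of radius
    its linear width. *)
Lemma capacity_ellipsoid p A : A \in unitmx ->
  c [set p + z | z in ellipsoid A] = (pi * lin_width (ellipsoid A) ^+ 2)%:E.
Proof.
move=> uA; have w0 := lin_width_gt0 n_gt0 uA.
have [Psi [r [[sP r0 wr wr0 PE] _]]] := lin_width_ellipsoid n_gt0 uA.
set w := lin_width _ in w0 wr wr0 *.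
have [uP sP'] := symplectic_mx_inv sP.
have wn : w != 0 by rewrite gt_eqF.
have c_ball : c [set w *: z | z in cball n 1] = (pi * w ^+ 2)%:E.
  by rewrite (capacity_conformal cap) // (capacity_ball cap) -EFinM mulrC.
have c_cyl : c [set w *: z | z in cylinder1 R n] = (pi * w ^+ 2)%:E.
  by rewrite (capacity_conformal cap) // (capacity_cylinder cap) -EFinM mulrC.
apply/le_anti/andP; split.
  rewrite -c_cyl; apply: (capacity_affine (p := - (Psi *m p)) sP).
  move=> _ [_ [x xB <-] <-].
  have -> : affine (- (Psi *m p)) Psi (p + A *m x) = Psi *m A *m x.
    by rewrite /affine mulmxDr addrA addNr add0r mulmxA.
  have [y yB <-] : ellipsoid (polydiag r) (Psi *m A *m x).
    by rewrite -PE; exists x.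
  exists (w^-1 *: (polydiag r *m y)); last by rewrite scalerA mulfV // scale1r.
  move=> j /wr0 rj.
  have -> : xc (w^-1 *: (polydiag r *m y)) j = xc y j.
    by rewrite xcZ xc_polydiag -rj mulrA mulVf // mul1r.
  have -> : yc (w^-1 *: (polydiag r *m y)) j = yc y j.
    by rewrite ycZ yc_polydiag -rj mulrA mulVf // mul1r.
  move: yB; rewrite /Defs.cball /= enorm_le // expr1n dot_xyc => /(le_trans _); apply.
  rewrite (bigD1 j) //= -!expr2 lerDl sumr_ge0 // => k _.
  by rewrite addr_ge0 // -expr2 sqr_ge0.
rewrite -c_ball; apply: (capacity_affine (p := p) sP') => _ [x xB <-].
pose y := polydiag (fun j => w / r j) *m x.
have yB : cball n 1 y.
  apply: le_trans (enorm_polydiag_le _ _) xB => j.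
  by rewrite divr_ge0 ?(ltW w0) ?(ltW (r0 j)) // ler_pdivrMr ?r0 // mul1r wr.
have [x' x'B e] : ellipsoid (Psi *m A) (w *: x).
  rewrite PE; exists y => //; rewrite /y mulmxA; apply/matrixP => i j; rewrite ord1.
  rewrite -(splitK i); case: (fintype.split i) => k /=.
    rewrite -[LHS]/(xc _ k) -mulmxA !xc_polydiag -[RHS]/(xc (w *: x) k) xcZ mulrA.
    by rewrite mulrCA mulfV ?mulr1 // gt_eqF.
  rewrite -[LHS]/(yc _ k) -mulmxA !yc_polydiag -[RHS]/(yc (w *: x) k) ycZ mulrA.
  by rewrite mulrCA mulfV ?mulr1 // gt_eqF.
exists (A *m x'); first by exists x'.
by rewrite /affine -e -mulmxA mulKmx.
Qed.

End Capacity.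

Lemma lin_width_scale k A : (0 < n)%N -> 0 < k -> A \in unitmx ->
  lin_width (ellipsoid (k *: A)) = k * lin_width (ellipsoid A).
Proof.
move=> n0 k0 uA.
have ukA : k *: A \in unitmx by rewrite unitmxZ ?unitfE ?gt_eqF.
have w0 := lin_width_gt0 n0 uA; have w0' := lin_width_gt0 n0 ukA.
have scale lambda : width_bound (k *: A) lambda <-> width_bound A (k ^+ 2 * lambda).
  have e xi : enorm ((k *: A)^T *m xi) = k * enorm (A^T *m xi).
    by rewrite linearZ /= -scalemxAl enormZ gtr0_norm.
  split=> h xi eta; have := h xi eta; rewrite !e; congr (_ <= _); ring.
apply/eqP; rewrite -(eqrXn2 (n := 2)) ?mulr_ge0 ?(ltW w0) ?(ltW w0') ?(ltW k0) //.
apply/eqP/invr_inj/le_anti/andP.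
rewrite [(k * _) ^+ 2]exprMn [(k ^+ 2 * _)^-1]invfM.
have k2 : 0 < k ^+ 2 by rewrite exprn_gt0.
split.
  apply/(lin_width_boundP n0 _ ukA)/scale; rewrite mulrA mulfV ?gt_eqF // mul1r.
  by apply/(lin_width_boundP n0 _ uA).
rewrite mulrC ler_pdivrMr // mulrC.
by apply/(lin_width_boundP n0 _ uA)/scale/(lin_width_boundP n0 _ ukA).
Qed.

End AffineSymplectic.

(** * Images of small ellipsoids *)

Section StrictDifferentiability.
Variables (R : realType) (n : nat) (U : set (R2n R n)) (phi : R2n R n -> R2n R n).
Hypotheses (oU : open U) (smooth : Ck 1 U phi).

Lemma smooth_differentiable z : U z -> differentiable phi z.
Proof. by case: smooth => h _; exact: h. Qed.

Lemma diff_continuous_at v p e : U p -> 0 < e ->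
  exists2 d, 0 < d & forall z, enorm (z - p) < d -> U z /\
    enorm ('d phi z v - 'd phi p v) < e.
Proof.
move=> Up e0; case: smooth => _ /(_ v p Up) /continuous_enormP /(_ e e0)[d d0 hd].
have /nbhs_enormP[d' d'0 hd'] : nbhs p U by exact: open_nbhs_nbhs.
exists (Num.min d d') => [|z]; first by rewrite lt_min d0.
rewrite lt_min => /andP[zd zd']; split; first exact: hd'.
have := hd z zd; rewrite !deriveE //; apply: smooth_differentiable => //.
exact: hd'.
Qed.

Lemma diff_near p e : U p -> 0 < e ->
  exists2 d, 0 < d & forall z, enorm (z - p) < d -> U z /\
    forall v, enorm ('d phi z v - 'd phi p v) <= e * enorm v.
Proof.
move=> Up e0; pose e' := e / ((n + n)%:R + 1).
have e'0 : 0 < e' by rewrite divr_gt0 // ltr_wpDl.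
pose P (j : 'I_(n + n)) z := U z /\
    enorm ('d phi z (delta_mx j 0) - 'd phi p (delta_mx j 0)) < e'.
have h : nbhs p (fun z => forall j, P j z).
  apply: (@filter_forall _ _ P (nbhs p)) => j.
  by apply/nbhs_enormP; exact: diff_continuous_at.
have nU : nbhs p U by exact: open_nbhs_nbhs.
have [d d0 hd] := (nbhs_enormP p _).1 (filterI h nU).
exists d => // z /hd[hj Uz]; split=> // v.
have -> : 'd phi z v - 'd phi p v =
    \sum_j v j 0 *: ('d phi z (delta_mx j 0) - 'd phi p (delta_mx j 0)).
  apply: (etrans (congr2 (fun a b => a - b) (linear_cV_sum ('d phi z) v)
    (linear_cV_sum ('d phi p) v))).
  by rewrite -sumrB; apply: eq_bigr => j _; rewrite scalerBr.
apply: le_trans (_ : \sum_(j < n + n) e' * enorm v <= _); last first.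
  rewrite sumr_const card_ord -mulr_natl mulrA ler_wpM2r ?enorm_ge0 //.
  rewrite /e' mulrCA ler_piMr ?(ltW e0) // ler_pdivrMr ?ltr_wpDl // mul1r.
  by rewrite lerDl.
apply: (big_ind2 (fun x y => enorm x <= y)); first by rewrite enorm0.
  by move=> x1 y1 x2 y2 h1 h2; apply: le_trans (enormD _ _) _; exact: lerD.
move=> j _; rewrite enormZ mulrC ler_pM ?enorm_ge0 ?normr_ge0 ?enorm_coord //.
by have [_ /ltW] := hj j.
Qed.

Lemma continuous_dot (w : R2n R n) : continuous (dot w).
Proof.
move=> z; rewrite (_ : dot w = fun x => \sum_i w i 0 * x i 0); last first.
  by apply/funext => x; rewrite dotE.
apply: continuous_sum => i {}z.
apply: (@continuousM _ _ (fun=> w i 0) (fun y : R2n R n => y i 0) z).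
  exact: cst_continuous.
exact: coord_continuous.
Qed.

(** The difference quotient at s is the image under [dot w] of a difference
    quotient of phi in the direction v. *)
Lemma is_derive_line (w y v : R2n R n) (s : R) :
  differentiable phi (y + s *: v) ->
  is_derive s 1 (fun t : R => dot w (phi (y + t *: v)))
    (dot w ('d phi (y + s *: v) v)).
Proof.
move=> dphi; set x := y + s *: v in dphi *; set g := fun t => _.
have quotE : (fun h : R => h^-1 *: ((g \o shift s) (h *: 1) - g s)) =
    dot w \o (fun h : R => h^-1 *: ((phi \o shift x) (h *: v) - phi x)).
  apply/funext => h; rewrite /= /g dotZr dotBr; congr (_ * (dot w (phi _) - _)).
  by rewrite [h *: 1]mulr1 scalerDl addrCA /x.
have lim : (fun h : R => h^-1 *: ((g \o shift s) (h *: 1) - g s)) @ 0^' -->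
    dot w ('d phi x v).
  rewrite quotE -deriveE //; apply: continuous_cvg; first exact: continuous_dot.
  by have := diff_derivable (v := v) dphi.
split.
  by apply/cvg_ex; exists (dot w ('d phi x v)).
exact: cvg_lim.
Qed.

(** A C^1 map is strictly differentiable: apply the mean value theorem to the
    component of phi along the error vector. *)
Lemma strict_differentiability p e : U p -> 0 < e ->
  exists2 d, 0 < d & forall x y, enorm (x - p) < d -> enorm (y - p) < d ->
    enorm (phi x - phi y - 'd phi p (x - y)) <= e * enorm (x - y).
Proof.
move=> Up e0; have [d d0 hd] := diff_near Up e0.
exists d => // x y xd yd; set v := x - y.
have seg (t : R) : t \in `[0, 1]%R -> enorm (y + t *: v - p) < d.
  rewrite in_itv /= => /andP[t0 t1].
  have -> : y + t *: v - p = (1 - t) *: (y - p) + t *: (x - p).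
    by rewrite /v scalerBl scale1r !scalerBr; apply/matrixP => i j; rewrite !mxE; ring.
  apply: le_lt_trans (enormD _ _) _; rewrite !enormZ (ger0_norm t0).
  rewrite ger0_norm; last by lra.
  have [tt|tt] := leP t 2^-1; nra.
set w := phi x - phi y - 'd phi p v.
pose g (t : R) := dot w (phi (y + t *: v)).
have dg (t : R) : t \in `[0, 1]%R -> is_derive t (1 : R) g (dot w ('d phi (y + t *: v) v)).
  move=> /seg /hd[Uz _]; apply: is_derive_line; exact: smooth_differentiable.
pose dg' (t : R) := dot w ('d phi (y + t *: v) v).
have dgo (t : R) : t \in `]0, 1[%R -> is_derive t (1 : R) g (dg' t).
  by move=> /subset_itv_oo_cc; exact: dg.
have cg : {within `[0, 1], continuous g}.
  by apply: derivable_within_continuous => t /dg dt; exact: ex_derive.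
have [c c01] := MVT_segment (@ler01 R) dgo cg; rewrite /dg'.
have [_ hc] := hd _ (seg c c01).
have yv : y + v = x by rewrite /v addrC subrK.
rewrite subr0 mulr1 /g scale1r scale0r addr0 yv => ge.
have [->|w0] := eqVneq w 0; first by rewrite enorm0 mulr_ge0 ?enorm_ge0 ?ltW.
have ww : enorm w ^+ 2 = dot w ('d phi (y + c *: v) v - 'd phi p v).
  by rewrite enorm_sqr {2}/w !dotBr ge.
have nw : 0 < enorm w by rewrite enorm_gt0.
rewrite -(ler_pM2l nw) -expr2 ww; apply: le_trans (dot_le _ _) _.
by rewrite ler_pM2l.
Qed.

End StrictDifferentiability.

(** The join of the complete and of the normed structure of column vectors, on
    which the fixed point theorem acts. *)
HB.instance Definition _ (R : realType) m := Complete.copy 'M[R]_(m, 1) 'M[R]_(m, 1).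

(** Solving f u = y by iterating u |-> y - (f u - u).  The condition
    m q < 1 makes this map a contraction for the max norm. *)
Lemma perturbed_identity_onto (R : realType) m (f : 'cV[R]_m -> 'cV[R]_m) (q : R) :
  0 <= q -> m%:R * q < 1 -> q <= 1 -> f 0 = 0 ->
  (forall u v, enorm u <= 1 -> enorm v <= 1 ->
     enorm (f u - f v - (u - v)) <= q * enorm (u - v)) ->
  forall y, enorm y <= 1 - q -> exists2 u, enorm u <= 1 & f u = y.
Proof.
move=> q0 mq q1 f0 hf y hy.
pose B := [set u : 'cV[R]_m | enorm u <= 1].
pose g (u : 'cV[R]_m) := y - (f u - u).
have gB : {homo g : u / B u >-> B u}.
  move=> u Bu; have := hf u 0 Bu; rewrite enorm0 f0 !subr0 => /(_ ler01) hu.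
  have : q * enorm u <= q by rewrite ler_piMr.
  rewrite /B /= /g; have := enormB y (f u - u); lra.
have q'0 : 0 <= m%:R * q by rewrite mulr_ge0.
have ctr : is_contraction (mkfun_fun gB).
  exists (NngNum q'0); split=> //= -[u v] /= [Bu Bv].
  have -> : mkfun gB u - mkfun gB v = - (f u - f v - (u - v)).
    by rewrite /mkfun /g; apply/matrixP => i j; rewrite !mxE; ring.
  rewrite normrN; apply: le_trans (norm_le_enorm _) _.
  apply: le_trans (hf _ _ Bu Bv) _; rewrite (mulrC m%:R) -mulrA.
  by rewrite ler_wpM2l // enorm_le_norm.
have clB : closed B.
  rewrite (_ : B = (fun u : 'cV[R]_m => \sum_i u i 0 * u i 0) @^-1` [set x | x <= 1]).
    apply: preimage_closed; last exact: closed_le.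
    move=> u _; apply: continuous_sum => i {}u.
    by apply: (@continuousM _ _ (fun y : 'cV[R]_m => y i 0) (fun y : 'cV[R]_m => y i 0));
      exact: coord_continuous.
  by apply/funext => u; rewrite /B /= enorm_le // expr1n dotE.
have [|u Bu gu] := banach_fixed_point ctr clB; first by exists 0; rewrite /B /= enorm0.
by exists u => //; move/eqP: gu; rewrite /= /mkfun /g opprB addrCA -subr_eq0 opprD addNKr
  oppr_eq0 subr_eq0 => /eqP.
Qed.

Section Embeddings.
Variables (R : realType) (n : nat) (U : set (R2n R n)) (phi : R2n R n -> R2n R n).
Hypotheses (n_gt0 : (0 < n)%N) (oU : open U) (smooth : Ck 1 U phi).
Variables (p : R2n R n) (M : 'M[R]_(n + n)).
Hypotheses (Up : U p) (uM : M \in unitmx) (dphi : forall v, 'd phi p v = M *m v).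

(** Composing with the inverse of the differential and rescaling E(t A) to the
    unit ball turns phi into a map f that differs from the identity by a map
    with Lipschitz constant q; the outer inclusion is immediate and the inner one
    is [perturbed_identity_onto]. *)
Lemma image_small_ellipsoid A q : A \in unitmx -> 0 < q -> (n + n)%:R * q < 1 -> q < 1 ->
  exists2 t : R, 0 < t & let E := [set p + z | z in ellipsoid (t *: A)] in
    [/\ E `<=` U,
      [set phi p + z | z in ellipsoid (((1 - q) * t) *: (M *m A))] `<=` phi @` E &
      phi @` E `<=` [set phi p + z | z in ellipsoid (((1 + q) * t) *: (M *m A))]].
Proof.
move=> uA q0 mq q1; set D := M *m A.
have uD : D \in unitmx by rewrite unitmx_mul uM.
have [a a0 ha] := enorm_mulmx_le A.
have [b b0 hb] := enorm_mulmx_le (invmx D).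
pose e := q / (a * b + 1).
have ab0 : 0 < a * b + 1 by rewrite ltr_wpDl ?mulr_ge0.
have e0 : 0 < e by rewrite divr_gt0.
have [d1 d10 hd1] := strict_differentiability oU smooth Up e0.
have [d2 d20 hd2] := (nbhs_enormP p U).1 (open_nbhs_nbhs (conj oU Up)).
pose d := Num.min d1 d2.
have d0 : 0 < d by rewrite lt_min d10.
pose t := d / (a + 1).
have a1 : 0 < a + 1 by lra.
have t0 : 0 < t by rewrite divr_gt0.
have small u : enorm u <= 1 -> enorm ((t *: A) *m u) < d.
  move=> u1; rewrite -scalemxAl enormZ (gtr0_norm t0).
  apply: le_lt_trans (_ : t * a < _).
    by rewrite ler_wpM2l ?(ltW t0) //; apply: le_trans (ha _) _; rewrite ler_piMr.
  by rewrite /t mulrAC ltr_pdivrMr // ltr_pM2l //; lra.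
have inU u : enorm u <= 1 -> U (p + (t *: A) *m u).
  move=> /small; rewrite lt_min => /andP[_ ud]; apply: hd2.
  by rewrite addrC addKr.
pose f u := t^-1 *: (invmx D *m (phi (p + (t *: A) *m u) - phi p)).
have fE u : phi (p + (t *: A) *m u) = phi p + (t *: D) *m f u.
  rewrite -(scalemxAl t D) /f -(scalemxAr t^-1 D) scalerA mulfV ?gt_eqF // scale1r.
  by rewrite mulKVmx // [RHS]addrC subrK.
have f0 : f 0 = 0 by rewrite /f mulmx0 addr0 subrr mulmx0 scaler0.
have hf u v : enorm u <= 1 -> enorm v <= 1 ->
    enorm (f u - f v - (u - v)) <= q * enorm (u - v).
  move=> u1 v1; set x := p + (t *: A) *m u; set y := p + (t *: A) *m v.
  have -> : f u - f v - (u - v) = t^-1 *: (invmx D *m (phi x - phi y - M *m (x - y))).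
    have -> : M *m (x - y) = t *: (D *m (u - v)).
      by rewrite /x /y opprD addrACA subrr add0r -mulmxBr -scalemxAl -scalemxAr mulmxA.
    rewrite [in RHS]mulmxBr -[invmx D *m (t *: _)]scalemxAr mulKmx // scalerBr.
    rewrite scalerA mulVf ?gt_eqF // scale1r /f -/x -/y -scalerBr -mulmxBr.
    by rewrite opprB addrA subrK.
  rewrite enormZ gtr0_norm ?invr_gt0 //.
  rewrite ler_pdivrMl //; apply: le_trans (hb _) _.
  have xd : enorm (x - p) < d1.
    by have := small u u1; rewrite lt_min /x [p + _]addrC addrK => /andP[].
  have yd : enorm (y - p) < d1.
    by have := small v v1; rewrite lt_min /y [p + _]addrC addrK => /andP[].
  have := hd1 x y xd yd; rewrite dphi => h.
  have hxy : enorm (x - y) <= t * (a * enorm (u - v)).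
    rewrite /x /y opprD addrACA subrr add0r -mulmxBr -scalemxAl enormZ (gtr0_norm t0).
    by rewrite ler_wpM2l ?(ltW t0).
  apply: le_trans (ler_wpM2l b0 h) _.
  apply: le_trans (ler_wpM2l b0 (ler_wpM2l (ltW e0) hxy)) _.
  have -> : b * (e * (t * (a * enorm (u - v)))) = t * ((e * (a * b)) * enorm (u - v)).
    by ring.
  rewrite ler_wpM2l ?(ltW t0) // ler_wpM2r ?enorm_ge0 //.
  by rewrite /e mulrAC ler_pdivrMr // ler_wpM2l ?(ltW q0) //; lra.
exists t => // E; split.
- by move=> _ [_ [u u1 <-] <-]; exact: inU.
- move=> _ [_ [y y1 <-] <-].
  have [|u u1 fu] := perturbed_identity_onto (ltW q0) mq (ltW q1) f0 hf (y := (1 - q) *: y).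
    by rewrite enormZ ger0_norm ?subr_ge0 ?(ltW q1) // ler_piMr // subr_ge0 ltW.
  exists (p + (t *: A) *m u); first by exists ((t *: A) *m u) => //; exists u.
  by rewrite fE fu -!scalemxAl -scalemxAr scalerA mulrC.
- move=> _ [_ [_ [u u1 <-] <-] <-]; rewrite fE; exists ((t *: D) *m f u) => //.
  exists ((1 + q)^-1 *: f u); last first.
    rewrite -!scalemxAl -scalemxAr scalerA mulrAC mulfV ?mul1r //.
    by rewrite gt_eqF //; lra.
  rewrite /cball /= enormZ gtr0_norm ?invr_gt0 ?ler_pdivrMl ?mulr1; try lra.
  have := hf u 0 u1; rewrite enorm0 f0 !subr0 => /(_ ler01) hu.
  have := enormD (f u - u) u; rewrite subrK.
  have : q * enorm u <= q by rewrite ler_piMr // ltW.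
  by move: u1; rewrite /cball /=; lra.
Qed.

(** Capacities of ellipsoids are pi times squared widths, so the two inclusions
    of [image_small_ellipsoid] turn the capacity estimates into width estimates
    for the differential, up to the factors 1 + q and 1 - q.  The bound on the
    distortion is invariant under the rescaling by t. *)
Lemma preserves_capacity_quasi (c : set (R2n R n) -> \bar R) eps :
  capacity c -> 0 <= rho_excess eps -> preserves_capacity c eps U phi ->
  quasi_preserving (rho_excess eps) M.
Proof.
move=> cap q0 pres A a b uA a0 b0 hA hC d.
have uD : M *m A \in unitmx by rewrite unitmx_mul uM.
set w := lin_width (ellipsoid A); set W := lin_width (ellipsoid (M *m A)).
have w0 : 0 < w by exact: lin_width_gt0.
have W0 : 0 < W by exact: lin_width_gt0.
have d0 : 0 <= d by rewrite !mulr_ge0.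
pose m := (n + n)%:R : R.
have m0 : 0 <= m by [].
have key q : 0 < q -> (m + 1) * q < 1 ->
    w <= (1 + d) * ((1 + q) * W) /\ (d < 1 -> (1 - d) * ((1 - q) * W) <= w).
  move=> qp mq; have q1 : q < 1 by nra.
  have mq' : m * q < 1 by nra.
  have [t t0 [EU lowE upE]] := image_small_ellipsoid uA qp mq' q1.
  have utA : t *: A \in unitmx by rewrite unitmxZ ?unitfE ?gt_eqF.
  have hA' z : enorm ((t *: A) *m z) <= (t * a) * enorm z.
    by rewrite -scalemxAl enormZ (gtr0_norm t0) -mulrA ler_wpM2l ?(ltW t0).
  have hC' z : enorm (invmx (t *: A) *m z) <= (t^-1 * b) * enorm z.
    have it : 0 < t^-1 by rewrite invr_gt0.
    rewrite invmxZ // -scalemxAl enormZ (gtr0_norm it) -mulrA.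
    by rewrite ler_wpM2l ?(ltW it).
  have /andP[D0 Dd] : 0 <= distortion eps (t *: A) <= d.
    have -> : d = (t^-1 * b) * rho_excess eps * (t * a).
      by rewrite /d; field; rewrite gt_eqF.
    by apply: distortion_le => //; rewrite mulr_ge0 // ?invr_ge0 ltW.
  have cE := capacity_ellipsoid cap n_gt0 p utA.
  have [lo up] := pres (t *: A) p utA EU.
  have wE : lin_width (ellipsoid (t *: A)) = t * w by rewrite lin_width_scale.
  rewrite cE wE -!EFinM in lo up.
  have k1 : 0 < (1 + q) * t by rewrite mulr_gt0 //; lra.
  have k2 : 0 < (1 - q) * t by rewrite mulr_gt0 //; lra.
  have scaled k : 0 < k -> c [set phi p + z | z in ellipsoid (k *: (M *m A))] =
      (pi * (k * W) ^+ 2)%:E.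
    move=> k0; rewrite capacity_ellipsoid ?lin_width_scale //.
    by rewrite unitmxZ ?unitfE ?gt_eqF.
  have pi0 : 0 < pi :> R by exact: pi_gt0.
  split.
    have := le_trans lo (capacity_sub cap upE); rewrite scaled // lee_fin.
    rewrite mulrCA ler_pM2l // -exprMn ler_sqr ?nnegrE; first last.
    - by rewrite !mulr_ge0 ?(ltW W0) ?(ltW t0) //; lra.
    - by rewrite !mulr_ge0 ?(ltW w0) ?(ltW t0) // invr_ge0; lra.
    rewrite /s_ ler_pdivrMl; last by lra.
    rewrite [(1 + q) * t]mulrC -mulrA mulrCA ler_pM2l // => /le_trans; apply.
    by rewrite ler_wpM2r ?mulr_ge0 ?(ltW W0) //; lra.
  move=> d1; have := le_trans (capacity_sub cap lowE) (up (le_lt_trans Dd d1)).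
  rewrite scaled // lee_fin [leRHS]mulrCA ler_pM2l // -exprMn ler_sqr ?nnegrE; first last.
  - by rewrite !mulr_ge0 ?(ltW w0) ?(ltW t0) // invr_ge0; lra.
  - by rewrite !mulr_ge0 ?(ltW W0) ?(ltW t0) //; lra.
  rewrite /e_ ler_pdivlMl; last by lra.
  rewrite [(1 - q) * t]mulrC -mulrA mulrCA ler_pM2l //; apply: le_trans.
  by rewrite ler_wpM2r ?mulr_ge0 ?(ltW W0) //; lra.
(* The two estimates in key hold for all small q; q tends to 0. *)
have small e : 0 < e -> exists2 q, 0 < q & (m + 1) * q < 1 /\ q <= e.
  move=> e0; exists (Num.min e (m + 2)^-1); last split.
  - by rewrite lt_min e0 invr_gt0; lra.
  - apply: le_lt_trans (_ : (m + 1) * (m + 2)^-1 < 1).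
      by rewrite ler_wpM2l ?ge_min ?lexx ?orbT //; lra.
    by rewrite ltr_pdivrMr ?mul1r; lra.
  - by rewrite ge_min lexx.
split=> [|d1].
  apply/ler_addgt0Pr => e e0; have dW : 0 < (1 + d) * W by rewrite mulr_gt0 //; lra.
  have [q qp [mq qe]] := small _ (divr_gt0 e0 dW).
  have [h _] := key q qp mq; apply: le_trans h _.
  by move: qe; rewrite ler_pdivlMr //; lra.
apply/ler_addgt0Pr => e e0; have dW : 0 < (1 - d) * W by rewrite mulr_gt0 //; lra.
have [q qp [mq qe]] := small _ (divr_gt0 e0 dW).
have [_ /(_ d1) h] := key q qp mq.
by move: qe; rewrite ler_pdivlMr //; lra.
Qed.

End Embeddings.

(** * The alternative is global *)

Section Globalization.
Variables (R : realType) (n : nat).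
Hypothesis n_gt0 : (0 < n)%N.

Lemma open_oball (r : R) : open (oball n r).
Proof.
rewrite openE => z zr; apply/nbhs_enormP; exists (r - enorm z).
  by rewrite subr_gt0.
move=> y yz; have := enormD (y - z) z; rewrite subrK /oball /= => h.
by apply: le_lt_trans h _; lra.
Qed.

(** On the ball the value of the pullback on one pair of conjugate basis
    vectors is continuous, and it is never 0 when every differential is close
    to symplectic or anti-symplectic: so only one of the two cases occurs. *)
Lemma same_alternative (r k : R) (phi : R2n R n -> R2n R n) :
  Ck 1 (oball n r) phi -> 0 < r -> k < 1 ->
  (forall z, oball n r z ->
    form_norm (fun u v => pullback phi z u v - omega0 u v) <= k \/
    form_norm (fun u v => pullback phi z u v + omega0 u v) <= k) ->
  (forall z, oball n r z ->
    form_norm (fun u v => pullback phi z u v - omega0 u v) <= k) \/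
  (forall z, oball n r z ->
    form_norm (fun u v => pullback phi z u v + omega0 u v) <= k).
Proof.
move=> smooth r0 k1 alt; pose i0 := Ordinal n_gt0.
pose e : R2n R n := delta_mx (lshift n i0) 0.
pose f : R2n R n := delta_mx (rshift n i0) 0.
have [h hdef] : {h | forall z, h z = omega0 ('D_e phi z) ('D_f phi z)} by eexists.
have hE z : oball n r z -> pullback phi z e f = h z.
  by move=> zr; rewrite /pullback hdef !deriveE //; apply: (smooth_differentiable smooth).
have oef : omega0 e f = 1 by rewrite omega0_xy eqxx.
have lt0 : (lshift n i0 < rshift n i0)%N by rewrite /= addn0.
have hsymp z : oball n r z -> form_norm (fun u v => pullback phi z u v - omega0 u v) <= k -> 0 < h z.
  move=> zr hz; have := le_trans (form_norm_ge _ lt0) hz.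
  by rewrite /= -/e -/f hE // oef ler_norml; lra.
have hanti z : oball n r z -> form_norm (fun u v => pullback phi z u v + omega0 u v) <= k -> h z < 0.
  move=> zr hz; have := le_trans (form_norm_ge _ lt0) hz.
  by rewrite /= -/e -/f hE // oef ler_norml; lra.
have h_neq0 z : oball n r z -> h z != 0.
  by move=> zr; have [/(hsymp z zr)|/(hanti z zr)] := alt z zr;
    [exact: lt0r_neq0 | exact: ltr0_neq0].
have B0 : oball n r 0 by rewrite /oball /= enorm0.
have seg z (s : R) : oball n r z -> s \in `[0, 1]%R -> oball n r (s *: z).
  rewrite in_itv /= /oball /= => zr /andP[s0 s1]; rewrite enormZ (ger0_norm s0).
  by apply: le_lt_trans zr; rewrite ler_piMl ?enorm_ge0.
have cont z : oball n r z -> {within `[0, 1], continuous (fun s : R => h (s *: z))}.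
  move=> zr; rewrite (_ : (fun s : R => h (s *: z)) =
    fun s : R => omega0 ('D_e phi (s *: z)) ('D_f phi (s *: z))); last exact/funext.
  apply: continuous_in_subspaceT => s; rewrite inE => /(seg z s zr) sz.
  have cz : (t *: z) @[t --> s] --> s *: z by exact: scalel_continuous.
  have cD v i : ('D_v phi (t *: z)) i 0 @[t --> s] --> ('D_v phi (s *: z)) i 0.
    have cv : {for s *: z, continuous (fun y => 'D_v phi y)}.
      by case: smooth => _ /(_ v _ sz).
    have c1 := cvg_comp _ _ cz cv.
    exact: (cvg_comp _ _ c1 (@coord_continuous R _ _ i 0 _)).
  apply: cvg_big => [|j _]; first exact: pseudometric_normed_Zmodule.add_continuous.
  by apply: cvgB; apply: cvgM; exact: cD.
have same z : oball n r z -> 0 < h 0 * h z.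
  move=> zr; rewrite lt_neqAle eq_sym mulf_neq0 ?h_neq0 //= leNgt; apply/negP => hneg.
  have [|s s01 hs] := IVT (@ler01 R) (cont z zr) (v := 0).
    rewrite /= scale0r scale1r; move: (h 0) (h z) hneg => a b.
    rewrite ge_min le_max; case: (ltrgt0P a) => a0.
    + by rewrite pmulr_rlt0 // => /ltW ->; rewrite orbT.
    + by rewrite nmulr_rlt0 // => /ltW ->; rewrite orbT.
    + by rewrite a0 mul0r ltxx.
  by have := h_neq0 _ (seg z s zr s01); rewrite hs eqxx.
have [h0|h0] := alt 0 B0.
  left=> z zr; have [//|/(hanti z zr) hz] := alt z zr.
  by exfalso; move: (same z zr); rewrite (pmulr_rgt0 (h z) (hsymp 0 B0 h0)) ltNge (ltW hz).
right=> z zr; have [/(hsymp z zr) hz|//] := alt z zr.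
by exfalso; move: (same z zr); rewrite (nmulr_rgt0 (h z) (hanti 0 B0 h0)) ltNge (ltW hz).
Qed.

End Globalization.

Lemma form_sup_norm_le (R : realType) n (U : set (R2n R n)) beta (k : R) :
  (forall z, U z -> form_norm (beta z) <= k) -> (form_sup_norm U beta <= k%:E)%E.
Proof.
by move=> h; apply: ge_ereal_sup => _ [z Uz <-]; rewrite lee_fin h.
Qed.

Section Main.
Variables (R : realType) (n : nat) (eps : R).
Hypotheses (n_gt0 : (0 < n)%N) (eps0 : 0 <= eps).
Hypothesis eps1 : close_cst R n * Num.sqrt eps < 1.
Let K := close_cst R n * Num.sqrt eps.

Let q0 : 0 <= rho_excess eps.
Proof.
have c80 := close_cst_ge80 R n_gt0.
have s2 : Num.sqrt eps ^+ 2 = eps by rewrite sqr_sqrtr.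
have s0 : 0 <= Num.sqrt eps by exact: sqrtr_ge0.
have e1 := eps1; have e0 := eps0.
have s1 : Num.sqrt eps <= 2^-1 by nra.
have eb : 0 <= eps <= 2^-1 by rewrite eps0 -s2; nra.
by have /andP[] := rho_excess_bounds eb.
Qed.

Lemma linear_rigidity (Phi : {linear R2n R n -> R2n R n}) :
  lin_non_squeezing eps Phi -> lin_non_expanding eps Phi ->
  eps_symplectic K setT Phi \/ eps_anti_symplectic K setT Phi.
Proof.
move=> hs he; have [M PhiE] := linear_cV_mx Phi.
have uM := non_squeezing_unit n_gt0 q0 PhiE hs.
have qM := non_squeezing_quasi n_gt0 q0 PhiE hs he.
have -> : (Phi : R2n R n -> R2n R n) = affine 0 M.
  by apply/funext => u; rewrite PhiE /affine add0r.
have pb z u v : pullback (affine 0 M) z u v = omega0 (M *m u) (M *m v).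
  by rewrite /pullback !diff_affine.
have [h|h] := symplectic_or_anti n_gt0 eps0 eps1 uM qM; [left|right];
  apply: form_sup_norm_le => z _; apply: le_trans h;
  by rewrite le_eqVlt; apply/orP; left; apply/eqP; congr form_norm;
    apply/funext => u; apply/funext => v; rewrite pb.
Qed.

Lemma nonlinear_rigidity (r : R) (c : set (R2n R n) -> \bar R) (phi : R2n R n -> R2n R n) :
  0 < r -> capacity c -> smooth_embedding (oball n r) phi ->
  preserves_capacity c eps (oball n r) phi ->
  eps_symplectic K (oball n r) phi \/ eps_anti_symplectic K (oball n r) phi.
Proof.
move=> r0 cap [smooth inj _] pres.
have [] := same_alternative n_gt0 (smooth 1%N) r0 eps1.
- move=> z zr; have [M dM] := linear_cV_mx ('d phi z).
  have uM : M \in unitmx.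
    apply/negPn/negP => /kernel_singular[x x0 Mx].
    by move: x0; rewrite (inj z zr x 0) ?eqxx // !dM Mx mulmx0.
  have qM := preserves_capacity_quasi n_gt0 (@open_oball R n r) (smooth 1%N) zr uM dM cap q0 pres.
  have pb u v : pullback phi z u v = omega0 (M *m u) (M *m v).
    by rewrite /pullback !dM.
  have [h|h] := symplectic_or_anti n_gt0 eps0 eps1 uM qM; [left|right];
    apply: le_trans h;
    by rewrite le_eqVlt; apply/orP; left; apply/eqP; congr form_norm;
      apply/funext => u; apply/funext => v; rewrite pb.
- by move=> h; left; apply: form_sup_norm_le.
- by move=> h; right; apply: form_sup_norm_le.
Qed.

End Main.

Theorem proposition7p5 (R : realType) (n : nat) (n_ge1 : (1 <= n)%N) :
  exists (eps0 : R) (K : R -> R),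
    [/\ 0 < eps0 <= 1,
        forall eps, 0 <= eps < eps0 -> 0 <= K eps,
        K eps @[eps --> (0 : R)^'+] --> (0 : R) &
        forall eps : R, 0 <= eps < eps0 ->
          (forall Phi : {linear R2n R n -> R2n R n},
             lin_non_squeezing eps Phi -> lin_non_expanding eps Phi ->
             eps_symplectic (K eps) setT Phi \/
             eps_anti_symplectic (K eps) setT Phi)
          /\
          (forall (r : R) (c : set (R2n R n) -> \bar R)
                  (phi : R2n R n -> R2n R n),
             0 < r -> capacity c ->
             smooth_embedding (oball n r) phi ->
             preserves_capacity c eps (oball n r) phi ->
             eps_symplectic (K eps) (oball n r) phi \/
             eps_anti_symplectic (K eps) (oball n r) phi)].
Proof.
have c80 := close_cst_ge80 R n_ge1; set c := close_cst R n in c80.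
have c0 : 0 < c by lra.
exists (c ^- 2), (fun eps => c * Num.sqrt eps); split.
- rewrite invr_gt0 exprn_gt0 //= invf_le1 ?exprn_gt0 // exprn_ege1 //; lra.
- by move=> eps _; rewrite mulr_ge0 ?sqrtr_ge0 // ltW.
- apply: cvg_at_right_filter.
  have cK : {for (0 : R), continuous (fun x : R => c * Num.sqrt x)}.
    apply: (@continuousM _ _ (fun=> c) (fun x : R => Num.sqrt x) 0).
      exact: cst_continuous.
    exact: sqrt_continuous.
  by move: cK; rewrite /prop_for /continuous_at sqrtr0 mulr0.
- move=> eps /andP[e0 e1].
  have cs : c * Num.sqrt eps < 1.
    rewrite -ltr_pdivlMl // mulr1 -ltr_sqr ?nnegrE ?sqrtr_ge0 ?invr_ge0 ?(ltW c0) //.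
    by rewrite sqr_sqrtr // exprVn.
  split=> [Phi|r cc phi]; [exact: linear_rigidity | exact: nonlinear_rigidity].
Qed.
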